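(* Let $(G,c,\boldsymbol{b})$ be an instance of the robust transshipment problem under consistent flow constraints on an SP digraph $G=(V,A=A^{\mathrm{fix}}\cup A^{\mathrm{free}})$ with unique source $s$ and unique sink $t$. The two-shortest-paths algorithm described in the context computes an optimal robust $\boldsymbol{b}$-flow in $\mathcal{O}(|V|+|A|)$ time.
   Context: An instance $(G,c,\boldsymbol{b})$ of the robust transshipment problem under consistent flow constraints consists of: a (multi-)digraph $G=(V,A)$ whose arc set is divided into two disjoint sets, $A=A^{\mathrm{fix}}\cup A^{\mathrm{free}}$ (fixed and free arcs); an arc cost $c:A\to\mathbb{Z}_{\ge 0}$; a finite set of scenarios $\Lambda$; and for each $\lambda\in\Lambda$ vertex balances $b^\lambda:V\to\mathbb{Z}$ with $\sum_{v\in V}b^\lambda(v)=0$; write $\boldsymbol{b}=(b^1,\ldots,b^{|\Lambda|})$. There are no arc capacities. For $\lambda\in\Lambda$, a $b^\lambda$-flow is a function $f^\lambda:A\to\mathbb{Z}_{\ge 0}$ with $\sum_{a=(v,w)\in A}f^\lambda(a)-\sum_{a=(w,v)\in A}f^\lambda(a)=b^\lambda(v)$ for every $v\in V$; its cost is $c(f^\lambda)=\sum_{a\in A}c(a)\cdot f^\lambda(a)$. A robust $\boldsymbol{b}$-flow is a tuple $\boldsymbol{f}=(f^1,\ldots,f^{|\Lambda|})$ of $b^\lambda$-flows such that $f^\lambda(a)=f^{\lambda'}(a)$ for all $a\in A^{\mathrm{fix}}$ and all $\lambda,\lambda'\in\Lambda$; its cost is $c(\boldsymbol{f})=\max_{\lambda\in\Lambda}c(f^\lambda)$.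 It is optimal if it has minimum cost among all robust $\boldsymbol{b}$-flows. The instance has unique source $s$ (unique sink $t$) if in every scenario $s$ is the only vertex with positive balance ($t$ is the only vertex with negative balance). SP (series-parallel) digraphs are defined recursively: (1) a single arc $(o,q)$ is an SP digraph with origin $o$ and target $q$; (2) if $G_1$ (origin $o_1$, target $q_1$) and $G_2$ (origin $o_2$, target $q_2$) are SP digraphs, then so are their series composition (contract $q_1$ with $o_2$; origin $o_1$, target $q_2$) and their parallel composition (contract $o_1$ with $o_2$ to the origin and $q_1$ with $q_2$ to the target). SP digraphs may have parallel arcs. Without loss of generality, $s$ and $t$ are the origin and the target of $G$, and the scenarios are numbered so that $b^1(s)\le\cdots\le b^{|\Lambda|}(s)$. The algorithm: compute a shortest $(s,t)$-path $p^{\mathrm{free}}$ (with respect to $c$) in $G-A^{\mathrm{fix}}$ and a shortest $(s,t)$-path $p^{\mathrm{fix}}$ (with respect to $c$) in $G$. Here $A(p)$ is the arc set of a path $p$ and $c(p)$ the sum of its arc costs. If $c(p^{\mathrm{fix}})<c(p^{\mathrm{free}})$, set for every $\lambda\in\Lambda$: $f^\lambda(a)=b^1(s)$ for $a\in A(p^{\mathrm{fix}})\setminus A(p^{\mathrm{free}})$; $f^\lambda(a)=b^\lambda(s)-b^1(s)$ for $a\in A(p^{\mathrm{free}})\setminus A(p^{\mathrm{fix}})$; $f^\lambda(a)=b^\lambda(s)$ for $a\in A(p^{\mathrm{fix}})\cap A(p^{\mathrm{free}})$; $f^\lambda(a)=0$ otherwise. Else set for every $\lambda\in\Lambda$: $f^\lambda(a)=b^\lambda(s)$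 for $a\in A(p^{\mathrm{free}})$ and $f^\lambda(a)=0$ otherwise. Return $\boldsymbol{f}=(f^1,\ldots,f^{|\Lambda|})$. *)

(* Defs.v *)
(* MathComp world. *)
From mathcomp Require Import all_boot all_order all_algebra.
Set Implicit Arguments.
Unset Strict Implicit.
Unset Printing Implicit Defensive.
Import Order.TTheory GRing.Theory Num.Theory.
Local Open Scope ring_scope.

(** ** Multi-digraphs and series-parallel digraphs *)

Record digraph := Digraph {
  vertex : finType;
  arc_of : finType;
  src : arc_of -> vertex;
  tgt : arc_of -> vertex }.

Record st_digraph := STDigraph {
  graph :> digraph;
  origin : vertex graph;
  target : vertex graph }.

Definition single_arc (G : st_digraph) : Prop :=
  [/\ origin G != target G,
      forall v : vertex G, v = origin G \/ v = target G
    & exists a : arc_of G,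
        [/\ src a = origin G, tgt a = target G & forall a', a' = a]].

(* G is, up to isomorphism, the disjoint union of G1 and G2 in which x of G1 and
   y of G2 are identified exactly when [glue x y].  The maps hV and hA send the
   disjoint union onto G; no two arcs are identified. *)
Definition gluing (G1 G2 G : digraph)
    (glue : vertex G1 -> vertex G2 -> Prop)
    (hV : vertex G1 + vertex G2 -> vertex G)
    (hA : arc_of G1 + arc_of G2 -> arc_of G) : Prop :=
  [/\ bijective hA,
      (forall v, exists x, hV x = v),
      injective (fun x => hV (inl x)) /\ injective (fun y => hV (inr y)),
      (forall x y, hV (inl x) = hV (inr y) <-> glue x y)
    & (forall a, src (hA (inl a)) = hV (inl (src a))
              /\ tgt (hA (inl a)) = hV (inl (tgt a))) /\
      (forall a, src (hA (inr a)) = hV (inr (src a))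
              /\ tgt (hA (inr a)) = hV (inr (tgt a)))].

Definition series_composition (G1 G2 G : st_digraph) : Prop :=
  exists hV hA,
    [/\ @gluing G1 G2 G (fun x y => x = target G1 /\ y = origin G2) hV hA,
        origin G = hV (inl (origin G1))
      & target G = hV (inr (target G2))].

Definition parallel_composition (G1 G2 G : st_digraph) : Prop :=
  exists hV hA,
    [/\ @gluing G1 G2 G (fun x y => (x = origin G1 /\ y = origin G2) \/
                                    (x = target G1 /\ y = target G2)) hV hA,
        origin G = hV (inl (origin G1))
      & target G = hV (inl (target G1))].

Inductive series_parallel : st_digraph -> Prop :=
| SP_arc G : single_arc G -> series_parallel G
| SP_series G1 G2 G : series_parallel G1 -> series_parallel G2 ->
    series_composition G1 G2 G -> series_parallel G
| SP_parallel G1 G2 G : series_parallel G1 -> series_parallel G2 ->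
    parallel_composition G1 G2 G -> series_parallel G.

Definition SP_digraph (G : digraph) : Prop :=
  exists o q : vertex G, series_parallel (STDigraph o q).

(** ** Instances and robust flows *)

(* The scenarios are numbered by 'I_(last_scen.+1), so that there is at least one
   and [ord0] is the first; the free arcs are the complement of [fixed]. *)
Record instance := Instance {
  igraph : digraph;
  fixed : {set arc_of igraph};
  acost : arc_of igraph -> nat;
  last_scen : nat;
  balance : 'I_last_scen.+1 -> vertex igraph -> int;
  balance_sum : forall l, \sum_v balance l v = 0 }.

Section Flows.
Variable I : instance.
Local Notation V := (vertex (igraph I)).
Local Notation A := (arc_of (igraph I)).
Local Notation scen := ('I_(last_scen I).+1).

Definition is_flow (l : scen) (f : A -> int) : Prop :=
  (forall a, 0 <= f a) /\
  (forall v, \sum_(a | src a == v) f a - \sum_(a | tgt a == v) f a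
             = balance l v).

Definition flow_cost (f : A -> int) : int := \sum_a (acost a)%:Z * f a.

Definition robust_flow (f : scen -> A -> int) : Prop :=
  (forall l, is_flow l (f l)) /\
  (forall a, a \in fixed I -> forall l l', f l a = f l' a).

Definition robust_cost (f : scen -> A -> int) : int :=
  \big[Num.max/flow_cost (f ord0)]_(l : scen) flow_cost (f l).

Definition optimal_robust_flow (f : scen -> A -> int) : Prop :=
  robust_flow f /\ forall g, robust_flow g -> robust_cost f <= robust_cost g.

Definition unique_source (s : V) : Prop :=
  forall (l : scen) v, (0 < balance l v) = (v == s).

Definition unique_sink (t : V) : Prop :=
  forall (l : scen) v, (balance l v < 0) = (v == t).

Definition sorted_scenarios (s : V) : Prop :=
  forall l l' : scen, (l <= l')%N -> balance l s <= balance l' s.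

(** ** The two-shortest-paths algorithm *)

Fixpoint is_walk (x y : V) (p : seq A) : bool :=
  if p is a :: p' then (src a == x) && is_walk (tgt a) y p' else x == y.

(* An (x, y)-path of the graph without the arcs of F. *)
Definition is_path (F : {set A}) (x y : V) (p : seq A) : bool :=
  [&& is_walk x y p, uniq (x :: [seq tgt a | a <- p])
    & all (fun a => a \notin F) p].

Definition path_cost (p : seq A) : nat := \sum_(a <- p) acost a.

(* The possible results of a shortest-path computation; [None] means that there
   is no path, and then the cost is read as infinite and the arc set as empty. *)
Definition shortest_path (F : {set A}) (x y : V) (r : option (seq A)) : Prop :=
  match r with
  | Some p => is_path F x y p /\
              forall p', is_path F x y p' -> (path_cost p <= path_cost p')%N
  | None => forall p, ~~ is_path F x y p
  end.

Definition cheaper (r r' : option (seq A)) : bool :=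
  match r, r' with
  | Some p, Some p' => (path_cost p < path_cost p')%N
  | Some _, None => true
  | None, _ => false
  end.

Definition on_path (a : A) (r : option (seq A)) : bool :=
  if r is Some p then a \in p else false.

Definition two_paths_flow (s : V) (pfree pfix : option (seq A))
    (l : scen) (a : A) : int :=
  if cheaper pfix pfree then
    if on_path a pfix && ~~ on_path a pfree then balance ord0 s
    else if on_path a pfree && ~~ on_path a pfix
      then balance l s - balance ord0 s
    else if on_path a pfix && on_path a pfree then balance l s
    else 0
  else if on_path a pfree then balance l s else 0.

End Flows.

(** ** The machine model: unit-cost random access programs over the integers *)

(* Programs use finitely many integer registers and integer arrays, both named by
   natural numbers; [Cell k e] is the entry of array k at index e.  The only
   arithmetic operations are addition and subtraction, so that numbers grow by
   at most one bit per operation. *)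
Inductive expr :=
| Lit of int
| Reg of nat
| Cell of nat & expr
| Plus of expr & expr
| Minus of expr & expr.

Inductive test :=
| Leq of expr & expr
| Equal of expr & expr
| Not of test.

Inductive cmd :=
| Skip
| SetReg of nat & expr
| SetCell of nat & expr & expr
| Seq of cmd & cmd
| If of test & cmd & cmd
| While of test & cmd.

Record state := State { reg : nat -> int; cell : nat -> int -> int }.

Fixpoint eval (st : state) (e : expr) : int :=
  match e with
  | Lit z => z
  | Reg x => reg st x
  | Cell k e => cell st k (eval st e)
  | Plus e1 e2 => eval st e1 + eval st e2
  | Minus e1 e2 => eval st e1 - eval st e2
  end.

Fixpoint holds (st : state) (b : test) : bool :=
  match b with
  | Leq e1 e2 => eval st e1 <= eval st e2
  | Equal e1 e2 => eval st e1 == eval st e2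
  | Not b => ~~ holds st b
  end.

Definition set_reg (st : state) (x : nat) (z : int) : state :=
  State (fun y => if y == x then z else reg st y) (cell st).

Definition set_cell (st : state) (k : nat) (i z : int) : state :=
  State (reg st)
    (fun k' i' => if (k' == k) && (i' == i) then z else cell st k' i').

Fixpoint expr_time (e : expr) : nat :=
  match e with
  | Lit _ | Reg _ => 1
  | Cell _ e => (expr_time e).+1
  | Plus e1 e2 | Minus e1 e2 => (expr_time e1 + expr_time e2).+1
  end.

Fixpoint test_time (b : test) : nat :=
  match b with
  | Leq e1 e2 | Equal e1 e2 => (expr_time e1 + expr_time e2).+1
  | Not b => (test_time b).+1
  end.

(* [exec c st n st']: run from state st, the program c halts in state st' after
   n elementary steps. *)
Inductive exec : cmd -> state -> nat -> state -> Prop :=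
| exec_skip st : exec Skip st 1 st
| exec_reg st x e :
    exec (SetReg x e) st (expr_time e).+1 (set_reg st x (eval st e))
| exec_cell st k e1 e2 :
    exec (SetCell k e1 e2) st (expr_time e1 + expr_time e2).+1
      (set_cell st k (eval st e1) (eval st e2))
| exec_seq c1 c2 st n1 st1 n2 st2 :
    exec c1 st n1 st1 -> exec c2 st1 n2 st2 ->
    exec (Seq c1 c2) st (n1 + n2) st2
| exec_if b c1 c2 st n st' :
    exec (if holds st b then c1 else c2) st n st' ->
    exec (If b c1 c2) st (test_time b + n).+1 st'
| exec_while_done b c st :
    ~~ holds st b -> exec (While b c) st (test_time b).+1 st
| exec_while_step b c st n1 st1 n2 st2 :
    holds st b -> exec c st n1 st1 -> exec (While b c) st1 n2 st2 ->
    exec (While b c) st ((test_time b).+1 + n1 + n2) st2.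

(** ** Encoding of instances and of flows *)

(* Vertices and arcs are numbered from 0 by [enum_rank], in an arbitrary order.
   Registers 0-4 hold |V|, |A|, s, t and the number of scenarios; arrays 0-3 hold,
   for each arc, its tail, its head, its cost and whether it is fixed; array 4
   holds b^l(v) at index l * |V| + v.  All other memory is 0. *)
Definition encode (I : instance) (s t : vertex (igraph I)) : state :=
  let V := vertex (igraph I) in
  let A := arc_of (igraph I) in
  let vnum (v : V) : int := (enum_rank v : nat)%:Z in
  let regs : seq int :=
    [:: #|V|%:Z; #|A|%:Z; vnum s; vnum t; (last_scen I).+1%:Z] in
  let arrays : seq (seq int) :=
    [:: [seq vnum (src a) | a <- enum A];
        [seq vnum (tgt a) | a <- enum A];
        [seq (acost a)%:Z | a <- enum A];
        [seq (a \in fixed I : nat)%:Z | a <- enum A];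
        [seq balance l v | l <- enum 'I_(last_scen I).+1, v <- enum V]] in
  State (fun x => nth 0 regs x)
        (fun k i => if i is Posz j then nth 0 (nth [::] arrays k) j else 0).

(* Compact representation of f, with two numbers per arc, in arrays 5 and 6. *)
Definition holds_compact_flow (I : instance) (s : vertex (igraph I))
    (st : state) (f : 'I_(last_scen I).+1 -> arc_of (igraph I) -> int) : Prop :=
  forall l a, let i : int := (enum_rank a : nat)%:Z in
    f l a = cell st 5 i + cell st 6 i * balance l s.

(* Explicit representation of f: f^l(a) is at index l * |A| + a of array 7. *)
Definition holds_flow (I : instance)
    (st : state) (f : 'I_(last_scen I).+1 -> arc_of (igraph I) -> int) : Prop :=
  forall (l : 'I_(last_scen I).+1) (a : arc_of (igraph I)),
    cell st 7 (l * #|arc_of (igraph I)| + enum_rank a)%N%:Z = f l a.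

(* Main.v *)
Require Import Defs.
From mathcomp Require Import all_boot all_order all_algebra.
From mathcomp Require Import zify ring.
Set Implicit Arguments.
Unset Strict Implicit.
Unset Printing Implicit Defensive.
Import Order.TTheory GRing.Theory Num.Theory.
Local Open Scope ring_scope.

(** Optimality rests on linear programming duality.  Let m be the smallest
    balance of s and k its balance in a scenario l, so that k >= m.  Let D be a
    lower bound on the cost of all (s, t)-paths and E >= D a lower bound on the
    cost of those that avoid the fixed arcs.  A robust flow g satisfies
        cost (g l) >= (k - m) * E + m * D                                   [1]
    and if D and E are the costs of the two shortest paths, the two-paths flow
    attains this in every scenario.  When no free path exists, E may be
    arbitrarily large in [1]; a robust flow then forces k = m, and the flow along
    the single path is again optimal.

    The bound [1] is witnessed by two vertex potentials p and q: on a free arc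
    p rises by at most the cost and q does not rise; on a fixed arc p + q rises
    by at most the cost; and from s to t, p rises by at least E and p + q by at
    least D.  Weigh the rises of p with the flow g l and those of q with the flow
    of the first scenario.  Summed by parts they amount to at least the right-hand
    side of [1]; arc by arc they are bounded by the cost of g l, because the two
    flows agree on the fixed arcs.  The series-parallel structure provides p and
    q.  For s the origin and t the target this is an induction: in a series
    composition D and E are split ([split_bounds]), in a parallel composition the
    potentials of the two sides are pasted ([sp_tightly_certifiable]).  Since s
    and t may be any two vertices, a second induction treats pairs in general
    position ([sp_certifiable]).

    The program sorts the arcs topologically with Kahn's algorithm, relaxes them
    in that order, once for each of the two path problems, and follows the
    parent arcs back from t.  Every loop has a loop-free body and a variant
    bounded by the input size ([run_loop]), which gives the running time.  The
    topological order and the labels computed from it are first studied as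
    mathematical objects ([tree_labelsP]), because the potentials that turn the
    lengths of shortest paths into bounds D and E are read off from the same
    labels ([lower_bound_potential]). *)

(** * Series-parallel compositions *)

Lemma gluing_paste (G1 G2 G : digraph) glue hV hA (T : Type)
    (f1 : vertex G1 -> T) (f2 : vertex G2 -> T) :
  @gluing G1 G2 G glue hV hA -> (forall x y, glue x y -> f1 x = f2 y) ->
  exists f : vertex G -> T,
    (forall x, f (hV (inl x)) = f1 x) /\ (forall y, f (hV (inr y)) = f2 y).
Proof.
move=> [_ surj [inj1 inj2] glueP _] agree.
pose P v u := (forall x, hV (inl x) = v -> u = f1 x) /\
              (forall y, hV (inr y) = v -> u = f2 y).
have /fin_all_exists[f Pf]: forall v, exists u, P v u.
  move=> v; have [[x|y] <-] := surj v.
    exists (f1 x); split=> [x' /inj1 -> //|y' E].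
    by apply: agree; apply/glueP.
  exists (f2 y); split=> [x' E|y' /inj2 -> //].
  by apply/esym/agree/glueP.
exists f; split=> [x|y]; first exact: (Pf _).1.
exact: (Pf _).2.
Qed.

Lemma gluing_arc_ind (G1 G2 G : digraph) glue hV hA (P : arc_of G -> Prop) :
  @gluing G1 G2 G glue hV hA ->
  (forall a, P (hA (inl a))) -> (forall a, P (hA (inr a))) -> forall a, P a.
Proof. by move=> [[g _ gK] _ _ _ _] P1 P2 a; rewrite -(gK a); case: (g a). Qed.

Definition swap_sum (A B : Type) (z : A + B) : B + A :=
  match z with inl x => inr x | inr y => inl y end.

Lemma gluing_swap (G1 G2 G : digraph) glue hV hA :
  @gluing G1 G2 G glue hV hA ->
  @gluing G2 G1 G (fun y x => glue x y)
    (fun z => hV (swap_sum z)) (fun z => hA (swap_sum z)).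
Proof.
move=> [[g hK gK] surj [inj1 inj2] glueP [arcs1 arcs2]]; split=> //.
- exists (fun a => swap_sum (g a)) => [z|a]; first by rewrite hK; case: z.
  by rewrite -[RHS]gK; case: (g a).
- by move=> v; have [[x|y] <-] := surj v; [exists (inr x) | exists (inl y)].
- by move=> y x; rewrite -glueP; split=> ->.
Qed.

(** Acyclicity, together with the fact that no arc enters the origin and none
    leaves the target.  In a parallel composition the two ranks of the target
    differ; each rank is multiplied by the other one's maximum to make them
    agree. *)
Lemma sp_rank (G : st_digraph) : series_parallel G ->
  exists r : vertex G -> nat,
    [/\ r (origin G) = 0%N, (0 < r (target G))%N,
        forall v, (r v <= r (target G))%N
      & forall a : arc_of G, (r (src a) < r (tgt a))%N].
Proof.
elim=> {G} [G [neq_oq only_oq [a [src_a tgt_a only_a]]]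
  | G1 G2 G _ [r1 [o1 q1 max1 inc1]] _ [r2 [o2 q2 max2 inc2]] [hV [hA []]]
  | G1 G2 G _ [r1 [o1 q1 max1 inc1]] _ [r2 [o2 q2 max2 inc2]] [hV [hA []]]].
- exists (fun v => (v == target G) : nat); rewrite eqxx (negPf neq_oq); split=> //.
    by move=> v; case: (v == _).
  by move=> a'; rewrite (only_a a') src_a tgt_a eqxx (negPf neq_oq).
- move=> glueG -> ->.
  have [|r [rl rr]] := gluing_paste (f1 := r1)
    (f2 := fun y => (r1 (target G1) + r2 y)%N) glueG.
    by move=> x y [-> ->]; rewrite o2 addn0.
  have [_ surj _ _ [arcs1 arcs2]] := glueG.
  exists r; rewrite rl rr; split=> //; first by rewrite addn_gt0 q1.
    move=> v; have [[x|y] <-] := surj v; last by rewrite rr leq_add2l.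
    by rewrite rl (leq_trans (max1 x)) ?leq_addr.
  apply: (gluing_arc_ind glueG) => a.
    by have [-> ->] := arcs1 a; rewrite !rl.
  by have [-> ->] := arcs2 a; rewrite !rr ltn_add2l.
- move=> glueG -> ->.
  have [|r [rl rr]] := gluing_paste (f1 := fun x => (r1 x * r2 (target G2))%N)
    (f2 := fun y => (r1 (target G1) * r2 y)%N) glueG.
    by move=> x y [[-> ->]|[-> ->]]; rewrite // o1 o2 muln0.
  have [_ surj _ _ [arcs1 arcs2]] := glueG.
  exists r; rewrite !rl o1; split=> //; first by rewrite muln_gt0 q1.
    by move=> v; have [[x|y] <-] := surj v; rewrite ?rl ?rr (leq_mul2r, leq_mul2l)
      (max1, max2) orbT.
  apply: (gluing_arc_ind glueG) => a.
    by have [-> ->] := arcs1 a; rewrite !rl ltn_mul2r q2 inc1.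
  by have [-> ->] := arcs2 a; rewrite !rr ltn_mul2l q1 inc2.
Qed.

(** * Dual certificates *)

Definition rise (G : digraph) (p : vertex G -> int) (a : arc_of G) : int :=
  p (tgt a) - p (src a).

Definition feasible (G : digraph) (P : pred (arc_of G)) (c : arc_of G -> nat)
    (p : vertex G -> int) : Prop :=
  forall a, P a -> rise p a <= (c a)%:Z.

(** The dual constraints of the robust flow problem with two scenarios: p prices
    the flow of an arbitrary scenario and q that of the first one.  On a fixed
    arc both carry the same flow, so only the sum of the two prices is
    constrained. *)
Definition certificate (G : digraph) (fx : pred (arc_of G))
    (c : arc_of G -> nat) (p q : vertex G -> int) : Prop :=
  forall a, if fx a then is_true (rise p a + rise q a <= (c a)%:Z)
            else rise p a <= (c a)%:Z /\ rise q a <= 0.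

(** That D and E bound the costs of paths from below is expressed by potentials
    instead of paths: a potential restricts to the parts of a composition by
    mere composition with the embedding. *)
Definition distance_bounds (G : digraph) (fx : pred (arc_of G))
    (c : arc_of G -> nat) (s t : vertex G) (D E : int) : Prop :=
  [/\ D <= E, exists2 p, feasible predT c p & D <= p t - p s
    & exists2 p, feasible (predC fx) c p & E <= p t - p s].

(** Inequalities suffice for the cost bound, and for vertices in general position
    equalities p t - p s = E and q t - q s = D - E would be too much: a path of
    free arcs from t to s forces q s <= q t, although E may exceed D. *)
Definition certifiable (G : digraph) (s t : vertex G) : Prop :=
  forall fx c D E, distance_bounds fx c s t D E ->
  exists p q : vertex G -> int,
    [/\ certificate fx c p q, E <= p t - p s & D <= p t - p s + (q t - q s)].

(** Equalities at the terminals allow the two sides of a parallel composition to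
    be pasted. *)
Definition tightly_certifiable (G : st_digraph) : Prop :=
  forall fx c D E, distance_bounds fx c (origin G) (target G) D E ->
  exists p q : vertex G -> int,
    [/\ certificate fx c p q, p (origin G) = 0, q (origin G) = 0,
        p (target G) = E & q (target G) = D - E].

(** The first part receives the whole distance d1; its free distance is taken as
    large as possible, up to d1 + E - D, beyond which the second part would be
    left with less than its share D - d1. *)
Lemma split_bounds (d1 d2 e1 e2 D E : int) :
  D <= E -> D <= d1 + d2 -> E <= e1 + e2 ->
  exists D1 D2 E1 E2 : int,
    [/\ D1 + D2 = D, E1 + E2 = E, D1 <= E1, D2 <= E2
      & [/\ D1 <= d1, D2 <= d2, E1 <= e1 \/ E1 <= d1 & E2 <= e2 \/ E2 <= d2]].
Proof.
move=> leDE leD leE.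
pose m1 := if e1 <= d1 then d1 else e1.
pose E1 := if m1 <= d1 + E - D then m1 else d1 + E - D.
exists d1, (D - d1), E1, (E - E1); rewrite /E1 /m1.
case: (leP e1 d1) => h1; case: ifP => h2; repeat split; lia.
Qed.

Lemma distance_bounds_free (G : digraph) (fx : pred (arc_of G)) c s t (D E : int) d e :
  D <= E -> feasible predT c d -> feasible (predC fx) c e ->
  D <= d t - d s -> E <= e t - e s \/ E <= d t - d s ->
  distance_bounds fx c s t D E.
Proof.
move=> leDE fd fe leD leE; split=> //; first by exists d.
by case: leE => leE; [exists e | exists d => // a _; apply: fd].
Qed.

Section Gluing.
Variables (G1 G2 G : digraph) (glue : vertex G1 -> vertex G2 -> Prop).
Variables (hV : vertex G1 + vertex G2 -> vertex G).
Variables (hA : arc_of G1 + arc_of G2 -> arc_of G).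
Hypothesis glueG : @gluing G1 G2 G glue hV hA.

Lemma rise_inl (p : vertex G -> int) a :
  rise p (hA (inl a)) = rise (fun x => p (hV (inl x))) a.
Proof. by have [_ _ _ _ [/(_ a)[Es Et] _]] := glueG; rewrite /rise Es Et. Qed.

Lemma rise_inr (p : vertex G -> int) a :
  rise p (hA (inr a)) = rise (fun y => p (hV (inr y))) a.
Proof. by have [_ _ _ _ [_ /(_ a)[Es Et]]] := glueG; rewrite /rise Es Et. Qed.

Lemma feasible_inl P c p : feasible P c p ->
  feasible (fun a => P (hA (inl a))) (fun a => c (hA (inl a)))
    (fun x => p (hV (inl x))).
Proof. by move=> fp a Pa; rewrite -rise_inl; apply: fp. Qed.

Lemma feasible_inr P c p : feasible P c p ->
  feasible (fun a => P (hA (inr a))) (fun a => c (hA (inr a)))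
    (fun x => p (hV (inr x))).
Proof. by move=> fp a Pa; rewrite -rise_inr; apply: fp. Qed.

Lemma distance_bounds_inl fx c x x' D E :
  distance_bounds fx c (hV (inl x)) (hV (inl x')) D E ->
  distance_bounds (fun a => fx (hA (inl a))) (fun a => c (hA (inl a))) x x' D E.
Proof.
move=> [leDE [d fd leD] [e fe leE]]; split=> //.
  by exists (fun x => d (hV (inl x))) => //; apply: (feasible_inl fd).
by exists (fun x => e (hV (inl x))) => //; apply: (feasible_inl fe).
Qed.

Lemma distance_bounds_inr fx c x x' D E :
  distance_bounds fx c (hV (inr x)) (hV (inr x')) D E ->
  distance_bounds (fun a => fx (hA (inr a))) (fun a => c (hA (inr a))) x x' D E.
Proof.
move=> [leDE [d fd leD] [e fe leE]]; split=> //.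
  by exists (fun x => d (hV (inr x))) => //; apply: (feasible_inr fd).
by exists (fun x => e (hV (inr x))) => //; apply: (feasible_inr fe).
Qed.

Lemma certificate_paste fx c p1 q1 p2 q2 :
  certificate (fun a => fx (hA (inl a))) (fun a => c (hA (inl a))) p1 q1 ->
  certificate (fun a => fx (hA (inr a))) (fun a => c (hA (inr a))) p2 q2 ->
  (forall x y, glue x y -> p1 x = p2 y /\ q1 x = q2 y) ->
  exists p q : vertex G -> int,
    [/\ certificate fx c p q,
        forall x, p (hV (inl x)) = p1 x /\ q (hV (inl x)) = q1 x
      & forall y, p (hV (inr y)) = p2 y /\ q (hV (inr y)) = q2 y].
Proof.
move=> cert1 cert2 agree.
have [p [pl pr]] := gluing_paste glueG (fun x y xy => (agree x y xy).1).
have [q [ql qr]] := gluing_paste glueG (fun x y xy => (agree x y xy).2).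
exists p, q; split=> //.
apply: (gluing_arc_ind glueG) => a; rewrite (rise_inl, rise_inr) (rise_inl, rise_inr).
  by rewrite /rise !pl !ql; apply: cert1.
by rewrite /rise !pr !qr; apply: cert2.
Qed.

End Gluing.

(** Costs are nonnegative, so potentials that rise nowhere satisfy every
    constraint.  They extend a certificate over a part of the graph that no
    (s, t)-path visits. *)
Lemma certificate_descent (G : digraph) (fx : pred (arc_of G)) c p q :
  (forall a, rise p a <= 0 /\ rise q a <= 0) -> certificate fx c p q.
Proof. by move=> desc a; have [] := desc a; case: ifP => _ ? ?; lia. Qed.

Lemma certificate_shift (G : digraph) (fx : pred (arc_of G)) c p q :
  certificate fx c p q -> forall x y : int,
  certificate fx c (fun v => p v + x) (fun v => q v + y).
Proof.
move=> cert x y a; have := cert a; rewrite /rise.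
by case: ifP => _; lia.
Qed.

(** In a series composition the certificate of the second part is shifted to
    match that of the first at the common vertex. *)
Lemma sp_tightly_certifiable (G : st_digraph) :
  series_parallel G -> tightly_certifiable G.
Proof.
elim=> {G} [G [neq_oq only_oq [a [src_a tgt_a only_a]]]
  | G1 G2 G sp1 IH1 sp2 IH2 [hV [hA [glueG Eo Eq]]]
  | G1 G2 G sp1 IH1 sp2 IH2 [hV [hA [glueG Eo Eq]]]] fx c D E.
- move=> [leDE [d fd leD] [e fe leE]].
  exists (fun v => if v == target G then E else 0),
         (fun v => if v == target G then D - E else 0).
  rewrite eqxx (negPf neq_oq); split=> // a'; rewrite (only_a a').
  rewrite /rise src_a tgt_a eqxx (negPf neq_oq).
  have := fd a isT; have := fe a; rewrite /rise src_a tgt_a /=.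
  by case: (fx a) => /= [_|/(_ isT)]; lia.
- rewrite Eo Eq => -[leDE [d fd leD] [e fe leE]].
  have [_ _ _ glueP _] := glueG.
  have Ej : hV (inl (target G1)) = hV (inr (origin G2)) by apply/glueP.
  pose j := hV (inl (target G1)).
  have [||D1 [D2 [E1 [E2 [defD defE le1 le2 [leD1 leD2 leE1 leE2]]]]]] :=
    @split_bounds (d j - d (hV (inl (origin G1)))) (d (hV (inr (target G2))) - d j)
      (e j - e (hV (inl (origin G1)))) (e (hV (inr (target G2))) - e j) D E leDE.
  + lia.
  + lia.
  have [|p1 [q1 [cert1 p1o q1o p1q q1q]]] :=
    IH1 (fun a => fx (hA (inl a))) (fun a => c (hA (inl a))) D1 E1.
    exact: (distance_bounds_free le1 (feasible_inl glueG fd) (feasible_inl glueG fe)).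
  have [|p2 [q2 [cert2 p2o q2o p2q q2q]]] :=
    IH2 (fun a => fx (hA (inr a))) (fun a => c (hA (inr a))) D2 E2.
    apply: (distance_bounds_free le2 (feasible_inr glueG fd) (feasible_inr glueG fe));
      by rewrite -Ej.
  have [|p [q [cert pl pr]]] := certificate_paste glueG cert1
      (certificate_shift cert2 E1 (D1 - E1)).
    by move=> x y [-> ->]; rewrite p1q q1q p2o q2o !add0r.
  exists p, q; split=> //.
  + by rewrite (pl _).1.
  + by rewrite (pl _).2.
  + by rewrite (pr _).1 p2q -defE addrC.
  + by rewrite (pr _).2 q2q; lia.
- rewrite Eo Eq => bounds.
  have [_ _ _ glueP _] := glueG.
  have Ej : hV (inl (target G1)) = hV (inr (target G2)) by apply/glueP; right.
  have Ei : hV (inl (origin G1)) = hV (inr (origin G2)) by apply/glueP; left.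
  have [p1 [q1 [cert1 p1o q1o p1q q1q]]] := IH1 _ _ _ _ (distance_bounds_inl glueG bounds).
  rewrite Ei Ej in bounds.
  have [p2 [q2 [cert2 p2o q2o p2q q2q]]] := IH2 _ _ _ _ (distance_bounds_inr glueG bounds).
  have [|p [q [cert pl pr]]] := certificate_paste glueG cert1 cert2.
    by move=> x y [[-> ->]|[-> ->]]; rewrite ?p1o ?p2o ?q1o ?q2o ?p1q ?p2q ?q1q ?q2q.
  by exists p, q; split; rewrite ?(pl _).1 ?(pl _).2.
Qed.

(** The case without (s, t)-path, where both bounds may be arbitrarily large. *)
Lemma certifiable_descent (G : digraph) (s t : vertex G) :
  (forall E : int, exists p : vertex G -> int,
     (forall a, rise p a <= 0) /\ E <= p t - p s) -> certifiable s t.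
Proof.
move=> desc fx c D E [leDE _ _]; have [p [desc_p lep]] := desc E.
exists p, (fun=> 0); split=> //; last by rewrite subrr addr0 (le_trans leDE).
by apply: certificate_descent => a; rewrite desc_p /rise subrr.
Qed.

(** Unless the two vertices are the origin and the target, no path between them
    passes through the second side, but the potentials of the first side may rise
    too much from the origin to the target.  No arc enters the origin and none
    leaves the target, so the origin may be raised (when it differs from the
    first vertex) or the target lowered (when it differs from the second) until
    both potentials fall from the origin to the target.  The second side then
    carries a descent. *)
Lemma par_certifiable_l (G1 G2 : st_digraph) (G : digraph) hV hA :
  series_parallel G1 -> series_parallel G2 ->
  @gluing G1 G2 G (fun x y => (x = origin G1 /\ y = origin G2) \/
                              (x = target G1 /\ y = target G2)) hV hA ->
  (forall x x' : vertex G1, certifiable x x') ->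
  forall x x' : vertex G1, certifiable (hV (inl x)) (hV (inl x')).
Proof.
move=> sp1 sp2 glueG IH x x' fx c D E bounds.
have [r1 [r1o r1q max1 inc1]] := sp_rank sp1.
have [r2 [r2o r2q max2 inc2]] := sp_rank sp2.
have noin1 (a : arc_of G1) : (tgt a == origin G1) = false.
  by apply/eqP => E1; have := inc1 a; rewrite E1 r1o.
have noout1 (a : arc_of G1) : (src a == target G1) = false.
  by apply/eqP => E1; have := inc1 a; rewrite E1 ltnNge max1.
have noin2 (a : arc_of G2) : (tgt a == origin G2) = false.
  by apply/eqP => E1; have := inc2 a; rewrite E1 r2o.
have noout2 (a : arc_of G2) : (src a == target G2) = false.
  by apply/eqP => E1; have := inc2 a; rewrite E1 ltnNge max2.
have neq1 : (target G1 == origin G1) = false.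
  by apply/eqP => E1; move: r1q; rewrite E1 r1o.
have neq2 : (target G2 == origin G2) = false.
  by apply/eqP => E1; move: r2q; rewrite E1 r2o.
have [_ _ _ glueP _] := glueG.
have [p1 [q1 [cert1 leE leD]]] := IH _ _ _ _ _ _ (distance_bounds_inl glueG bounds).
have [xo|xNo] := eqVneq x (origin G1); last first.
  pose raise (f : vertex G1 -> int) := Num.max (f (origin G1)) (f (target G1)).
  have raise_o f : f (origin G1) <= raise f by rewrite le_max lexx.
  have raise_q f : f (target G1) <= raise f by rewrite le_max lexx orbT.
  pose up (f : vertex G1 -> int) v := if v == origin G1 then raise f else f v.
  pose two (f : vertex G1 -> int) v :=
    if v == origin G2 then raise f else f (target G1).
  have [|||p [q [cert pl _]]] := certificate_paste (p1 := up p1) (q1 := up q1)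
    (p2 := two p1) (q2 := two q1) (fx := fx) (c := c) glueG.
  + move=> a; have := cert1 a; rewrite /rise /up noin1.
    case: (src a =P _) => [->|_]; last by [].
    by move: (raise_o p1) (raise_o q1); case: ifP => _; lia.
  + apply: certificate_descent => a; rewrite /rise /two noin2.
    by split; case: (src a == _); rewrite ?subrr // subr_le0.
  + by move=> _ _ [[-> ->]|[-> ->]]; rewrite /up /two ?eqxx ?neq1 ?neq2.
  exists p, q; rewrite !(pl _).1 !(pl _).2 /up (negPf xNo); split=> //.
    by case: eqP leE => // ->; move: (raise_o p1); lia.
  by case: eqP leD => // ->; move: (raise_o p1) (raise_o q1); lia.
have [xq|xNq] := eqVneq x' (target G1); last first.
  pose lower (f : vertex G1 -> int) := Num.min (f (origin G1)) (f (target G1)).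
  have lower_o f : lower f <= f (origin G1) by rewrite ge_min lexx.
  have lower_q f : lower f <= f (target G1) by rewrite ge_min lexx orbT.
  pose down (f : vertex G1 -> int) v := if v == target G1 then lower f else f v.
  pose two (f : vertex G1 -> int) v :=
    if v == target G2 then lower f else f (origin G1).
  have [|||p [q [cert pl _]]] := certificate_paste (p1 := down p1) (q1 := down q1)
    (p2 := two p1) (q2 := two q1) (fx := fx) (c := c) glueG.
  + move=> a; have := cert1 a; rewrite /rise /down noout1.
    case: (tgt a =P _) => [->|_]; last by [].
    by move: (lower_q p1) (lower_q q1); case: ifP => _; lia.
  + apply: certificate_descent => a; rewrite /rise /two noout2.
    by split; case: (tgt a == _); rewrite ?subrr // subr_le0.
  + by move=> _ _ [[-> ->]|[-> ->]]; rewrite /down /two ?eqxx // eq_sym ?neq1 eq_sym ?neq2.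
  exists p, q; rewrite !(pl _).1 !(pl _).2 /down (negPf xNq) xo eq_sym neq1.
  by rewrite -xo; split.
subst x x'.
have [p1' [q1' [cert1' p1o q1o p1q q1q]]] :=
  sp_tightly_certifiable sp1 (distance_bounds_inl glueG bounds).
have Ej : hV (inl (target G1)) = hV (inr (target G2)) by apply/glueP; right.
have Ei : hV (inl (origin G1)) = hV (inr (origin G2)) by apply/glueP; left.
rewrite Ei Ej in bounds.
have [p2' [q2' [cert2' p2o q2o p2q q2q]]] :=
  sp_tightly_certifiable sp2 (distance_bounds_inr glueG bounds).
have [|p [q [cert pl pr]]] := certificate_paste glueG cert1' cert2'.
  by move=> x y [[-> ->]|[-> ->]]; rewrite ?p1o ?p2o ?q1o ?q2o ?p1q ?p2q ?q1q ?q2q.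
by exists p, q; split; rewrite ?(pl _).1 ?(pl _).2 ?p1o ?p1q ?q1o ?q1q //; lia.
Qed.

(** Inner vertices of different sides are joined by no path: high at the origin
    and on the second side, zero on the first side and at the target is a
    descent. *)
Lemma par_certifiable_lr (G1 G2 : st_digraph) (G : digraph) hV hA :
  series_parallel G1 -> series_parallel G2 ->
  @gluing G1 G2 G (fun x y => (x = origin G1 /\ y = origin G2) \/
                              (x = target G1 /\ y = target G2)) hV hA ->
  forall (x : vertex G1) (y : vertex G2), x != origin G1 -> y != target G2 ->
  certifiable (hV (inl x)) (hV (inr y)).
Proof.
move=> sp1 sp2 glueG x y xNo yNq; apply: certifiable_descent => E.
have [r1 [r1o r1q max1 inc1]] := sp_rank sp1.
have [r2 [r2o r2q max2 inc2]] := sp_rank sp2.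
have [|p [pl pr]] := gluing_paste (f1 := fun v => if v == origin G1 then `|E| else 0)
    (f2 := fun v => if v == target G2 then 0 else `|E|) glueG.
  move=> _ _ [[-> ->]|[-> ->]]; rewrite eqxx; case: eqP => // E1.
    by move: r2q; rewrite -E1 r2o.
  by move: r1q; rewrite E1 r1o.
exists p; rewrite pl pr (negPf xNo) (negPf yNq) subr0 ler_norm; split=> //.
apply: (gluing_arc_ind glueG) => a.
  rewrite (rise_inl glueG) /rise !pl; case: (tgt a =P _) => [E1|_].
    by have := inc1 a; rewrite E1 r1o.
  by case: ifP => _; lia.
rewrite (rise_inr glueG) /rise !pr; case: (src a =P _) => [E1|_].
  by have := inc2 a; rewrite E1 ltnNge max2.
by case: ifP => _; lia.
Qed.

(** A composition is reduced to the parts that contain s and t.  What remains are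
    pairs without path between them and, in a series composition, s in the first
    part and t in the second. *)
Theorem sp_certifiable (G : st_digraph) :
  series_parallel G -> forall s t : vertex G, certifiable s t.
Proof.
elim=> {G} [G [neq_oq only_oq [a [src_a tgt_a only_a]]] s t
  | G1 G2 G sp1 IH1 sp2 IH2 [hV [hA [glueG Eo Eq]]] s t
  | G1 G2 G sp1 IH1 sp2 IH2 [hV [hA [glueG Eo Eq]]] s t].
- have [->|neq] := eqVneq s t.
    move=> fx c D E [leDE [d _ leD] [e _ leE]].
    exists (fun=> 0), (fun=> 0); split; [|lia|lia].
    by apply: certificate_descent => a'; rewrite /rise subrr.
  have [so|sq] := only_oq s.
    have [E1|tq] := only_oq t; first by move: neq; rewrite so E1 eqxx.
    have sp : series_parallel G by apply: SP_arc; split=> //; exists a.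
    rewrite so tq => fx c D E /(sp_tightly_certifiable sp).
    move=> [p [q [cert po qo pq qq]]]; exists p, q; split=> //; lia.
  apply: certifiable_descent => E.
  exists (fun v => if v == s then 0 else `|E|).
  rewrite eqxx eq_sym (negPf neq) subr0 ler_norm; split=> // a'.
  by rewrite (only_a a') /rise src_a tgt_a sq eqxx; case: ifP => _; lia.
- have [_ surj _ glueP _] := glueG.
  have Ej : hV (inl (target G1)) = hV (inr (origin G2)) by apply/glueP.
  have both1 x x' : certifiable (hV (inl x)) (hV (inl x')).
    move=> fx c D E bounds.
    have [p1 [q1 [cert1 leE leD]]] := IH1 _ _ _ _ _ _ (distance_bounds_inl glueG bounds).
    have [||p [q [cert pl _]]] := certificate_paste (p2 := fun=> p1 (target G1))
      (q2 := fun=> q1 (target G1)) glueG cert1.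
    + by apply: certificate_descent => a; rewrite /rise !subrr.
    + by move=> _ _ [-> _].
    by exists p, q; rewrite !(pl _).1 !(pl _).2.
  have both2 y y' : certifiable (hV (inr y)) (hV (inr y')).
    move=> fx c D E bounds.
    have [p2 [q2 [cert2 leE leD]]] := IH2 _ _ _ _ _ _ (distance_bounds_inr glueG bounds).
    have [||p [q [cert _ pr]]] := certificate_paste (p1 := fun=> p2 (origin G2))
      (q1 := fun=> q2 (origin G2)) (fx := fx) (c := c) glueG _ cert2.
    + by apply: certificate_descent => a; rewrite /rise !subrr.
    + by move=> _ _ [_ ->].
    by exists p, q; rewrite !(pr _).1 !(pr _).2.
  have [[x|y] <-] := surj s; have [[x'|y'] <-] := surj t; [exact: both1 | | | exact: both2].
    move=> fx c D E [leDE [d fd leD] [e fe leE]].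
    pose j := hV (inl (target G1)).
    have [||D1 [D2 [E1 [E2 [defD defE le1 le2 [leD1 leD2 leE1 leE2]]]]]] :=
      @split_bounds (d j - d (hV (inl x))) (d (hV (inr y')) - d j)
        (e j - e (hV (inl x))) (e (hV (inr y')) - e j) D E leDE; [lia | lia | ].
    have [|p1 [q1 [cert1 leE1' leD1']]] :=
      IH1 x (target G1) (fun a => fx (hA (inl a))) (fun a => c (hA (inl a))) D1 E1.
      exact: (distance_bounds_free le1 (feasible_inl glueG fd) (feasible_inl glueG fe)).
    have [|p2 [q2 [cert2 leE2' leD2']]] :=
      IH2 (origin G2) y' (fun a => fx (hA (inr a))) (fun a => c (hA (inr a))) D2 E2.
      apply: (distance_bounds_free le2 (feasible_inr glueG fd) (feasible_inr glueG fe));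
        by rewrite -Ej.
    have [|p [q [cert pl pr]]] := certificate_paste glueG cert1 (certificate_shift cert2
        (p1 (target G1) - p2 (origin G2)) (q1 (target G1) - q2 (origin G2))).
      by move=> _ _ [-> ->]; split; lia.
    by exists p, q; rewrite !(pl _).1 !(pl _).2 !(pr _).1 !(pr _).2; split=> //; lia.
  have [->|yNo] := eqVneq y (origin G2); first by rewrite -Ej; apply: both1.
  (* Here s lies strictly behind the common vertex and t does not, so no path
     leads from s to t. *)
  have [r2 [r2o _ _ inc2]] := sp_rank sp2.
  apply: certifiable_descent => E.
  have [|p [pl pr]] := gluing_paste (f1 := fun=> `|E|)
      (f2 := fun v => if v == origin G2 then `|E| else 0) glueG.
    by move=> _ _ [_ ->]; rewrite eqxx.
  exists p; rewrite pl pr (negPf yNo) subr0 ler_norm; split=> //.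
  apply: (gluing_arc_ind glueG) => a.
    by rewrite (rise_inl glueG) /rise !pl subrr.
  rewrite (rise_inr glueG) /rise !pr; case: (tgt a =P _) => [E1|_].
    by have := inc2 a; rewrite E1 r2o.
  by case: ifP => _; lia.
- have [_ surj _ glueP _] := glueG.
  have Ej : hV (inl (target G1)) = hV (inr (target G2)) by apply/glueP; right.
  have Ei : hV (inl (origin G1)) = hV (inr (origin G2)) by apply/glueP; left.
  have glueS := gluing_swap glueG.
  have glueS' : @gluing G2 G1 G (fun y x => (y = origin G2 /\ x = origin G1) \/
      (y = target G2 /\ x = target G1)) (fun z => hV (swap_sum z))
      (fun z => hA (swap_sum z)).
    have [bij surjS injS glueSP arcsS] := glueS; split=> // y x; rewrite glueSP.
    by split=> [[[]|[]]|[[]|[]]]; tauto.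
  have both1 := par_certifiable_l sp1 sp2 glueG IH1.
  have both2 := par_certifiable_l sp2 sp1 glueS' IH2.
  have [[x|y] <-] := surj s; have [[x'|y'] <-] := surj t;
    [exact: both1 | | | exact: both2].
    have [->|xNo] := eqVneq x (origin G1); first by rewrite Ei; apply: both2.
    have [->|yNq] := eqVneq y' (target G2); first by rewrite -Ej; apply: both1.
    exact: (par_certifiable_lr sp1 sp2 glueG xNo yNq).
  have [->|yNo] := eqVneq y (origin G2); first by rewrite -Ei; apply: both1.
  have [->|xNq] := eqVneq x' (target G1); first by rewrite Ej; apply: both2.
  exact: (par_certifiable_lr sp2 sp1 glueS' yNo xNq).
Qed.

(** * Paths and shortest-path labels *)

Section Paths.
Variable I : instance.
Local Notation V := (vertex (igraph I)).
Local Notation A := (arc_of (igraph I)).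
Variable r : V -> nat.
Hypothesis inc : forall a : A, (r (src a) < r (tgt a))%N.
Implicit Types (F : {set A}) (a : A) (x y v : V) (p : seq A).

Definition avoids F p := all (fun a => a \notin F) p.

Lemma walk_rank x y p : is_walk x y p ->
  all (fun a => r x < r (tgt a))%N p.
Proof.
elim: p x => //= a p IH x /andP[/eqP<- /IH walk_p].
rewrite inc; apply: sub_all walk_p => b; exact/ltn_trans/inc.
Qed.

Lemma walk_uniq_vertices x y p :
  is_walk x y p -> uniq (x :: [seq tgt a | a <- p]).
Proof.
elim: p x => //= a p IH x walk_ap; have /andP[_ /IH->] := walk_ap.
rewrite andbT; apply/negP => x_in.
have /mapP[b b_in Ex] : x \in [seq tgt b | b <- a :: p] by [].
by have /allP/(_ b b_in) := walk_rank (p := a :: p) walk_ap; rewrite -Ex ltnn.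
Qed.

Lemma walk_uniq x y p : is_walk x y p -> uniq p.
Proof. by move/walk_uniq_vertices => /= /andP[_]; apply: map_uniq. Qed.

Lemma is_path_walk F x y p :
  is_path F x y p = is_walk x y p && avoids F p.
Proof.
by rewrite /is_path; case walk_p: is_walk => //; rewrite (walk_uniq_vertices walk_p).
Qed.

Lemma path_cost_cons a p : path_cost (a :: p) = (acost a + path_cost p)%N.
Proof. by rewrite /path_cost big_cons. Qed.

(** A distance is stored plus one, so that 0 stands for an unreached vertex.  This
    is the state of a memory that is 0 at the start. *)
Record labels := Labels { dist : V -> nat; parent : V -> option A }.

Definition improves F (L : labels) a :=
  [&& a \notin F, dist L (src a) != 0 &
     (dist L (tgt a) == 0) || (dist L (src a) + acost a < dist L (tgt a))]%N.

Definition relax F (L : labels) a : labels :=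
  if improves F L a then
    Labels (fun v => if v == tgt a then dist L (src a) + acost a else dist L v)%N
           (fun v => if v == tgt a then Some a else parent L v)
  else L.

Definition start_labels (s : V) : labels :=
  Labels (fun v => v == s : nat) (fun=> None).

Definition tree_labels F s (l : seq A) : labels := foldl (relax F) (start_labels s) l.

(** No arc enters the tail of an earlier arc: all arcs into a vertex precede all
    arcs out of it.  Hence the label of a tail is final when one of its arcs is
    relaxed. *)
Definition topological (l : seq A) := pairwise (fun a b => tgt b != src a) l.

Lemma topological_order : exists2 l : seq A, topological l & forall a, a \in l.
Proof.
pose le (a b : A) := (r (src a) <= r (src b))%N.
exists (sort le (enum A)); last by move=> a; rewrite mem_sort mem_enum.
have: sorted le (sort le (enum A)) by apply: sort_sorted => a b; apply: leq_total.
rewrite sorted_pairwise; last by move=> b a c; apply: leq_trans.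
apply: sub_pairwise => a b le_ab; apply: contraTneq (inc b) => ->.
by rewrite -leqNgt.
Qed.

Section Tree.
Variables (F : {set A}) (s : V).

(** Optimality of the labels along the arcs of l, and for each reached vertex
    other than s a tight parent arc. *)
Definition tree_invariant (L : labels) (l : seq A) : Prop :=
  [/\ dist L s = 1,
      forall a, a \in l -> a \notin F -> (0 < dist L (src a) ->
        0 < dist L (tgt a) <= dist L (src a) + acost a)
    & forall v, 0 < dist L v -> v != s -> exists a,
        [/\ parent L v = Some a, tgt a = v, a \in l, a \notin F &
            0 < dist L (src a) /\ dist L v = dist L (src a) + acost a]]%N.

(** Relaxing an arc changes only the label of its head.  None of the relaxed arcs
    starts there, by the topological order, so neither their slack nor
    the tightness of their parent arcs is affected. *)
Lemma tree_labelsP l : topological l -> tree_invariant (tree_labels F s l) l.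
Proof.
elim/last_ind: l => [|l a IH].
  by move=> _; split=> [/=||v] //=; rewrite ?eqxx //; case: eqP.
rewrite /topological pairwise_rcons => /andP[/allP fresh /IH].
rewrite /tree_labels foldl_rcons -/(tree_labels F s l).
set L := tree_labels F s l; rewrite /relax /improves => -[Ls slack par].
have loopless : src a == tgt a = false.
  by apply/eqP => E; have := inc a; rewrite E ltnn.
case aF: (a \in F) => /=.
  split=> // [b|v Lv vs].
    rewrite mem_rcons inE => /predU1P[->|/slack//].
    by rewrite aF.
  have [b [p1 p2 p3 p4 p5]] := par v Lv vs; exists b; split=> //.
  by rewrite mem_rcons inE p3 orbT.
case La: (dist L (src a)) => [|k] /=.
  split=> // [b|v Lv vs].
    by rewrite mem_rcons inE => /predU1P[->|/slack//]; rewrite La.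
  have [b [p1 p2 p3 p4 p5]] := par v Lv vs; exists b; split=> //.
  by rewrite mem_rcons inE p3 orbT.
rewrite -La; case: ifP => [better|worse]; last first.
  split=> // [b|v Lv vs].
    rewrite mem_rcons inE => /predU1P[->|/slack//] _ _.
    by move: worse; case: (dist L (tgt a)) => [|m] //=; rewrite ltnNge => /negbFE.
  have [b [p1 p2 p3 p4 p5]] := par v Lv vs; exists b; split=> //.
  by rewrite mem_rcons inE p3 orbT.
have neq_s : s == tgt a = false.
  apply/eqP => E; move: better; rewrite -E Ls La /=.
  by rewrite addSn ltnS ltn0.
have stable b : b \in l -> src b == tgt a = false.
  by move=> /fresh; rewrite eq_sym => /negPf.
split=> /= [|b|v]; first by rewrite neq_s.
  rewrite mem_rcons inE => /predU1P[->|bl] bF; first by rewrite eqxx loopless La leqnn.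
  rewrite (stable b bl) => Lb; have := slack b bl bF Lb.
  case: eqP => // ->; move: better; rewrite La.
  by case: (dist L (tgt a)) => //= m; lia.
case: eqP => [-> _ _|neq Lv vs].
  by exists a; rewrite loopless mem_rcons mem_head aF La.
have [b [p1 p2 p3 p4 p5]] := par v Lv vs; exists b.
by rewrite (stable b p3) mem_rcons inE p3 orbT.
Qed.

Variable l : seq A.
Hypotheses (topo_l : topological l) (full_l : forall a, a \in l).
Let L := tree_labels F s l.

Lemma dist_walk x y p : is_walk x y p -> avoids F p -> (0 < dist L x)%N ->
  (0 < dist L y <= dist L x + path_cost p)%N.
Proof.
have [_ slack _] := tree_labelsP topo_l.
elim: p x => [|a p IH] x /=; first by move/eqP<- => _ ->; rewrite leq_addr.
move=> /andP[/eqP<- walk_p] /andP[aF avoid_p] Lx; rewrite path_cost_cons.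
have /andP[Ly le1] := slack a (full_l a) aF Lx.
have /andP[-> le2] := IH _ walk_p avoid_p Ly.
by rewrite (leq_trans le2) // addnA leq_add2r.
Qed.

Lemma dist_source : dist L s = 1%N.
Proof. by have [] := tree_labelsP topo_l. Qed.

Lemma walk_dist y p : is_walk s y p -> avoids F p ->
  (0 < dist L y <= (path_cost p).+1)%N.
Proof.
by move=> walk_p avoid_p; have := dist_walk walk_p avoid_p; rewrite dist_source => ->.
Qed.

(** Following the parent arcs terminates because the rank decreases. *)
Lemma dist_attained y : (0 < dist L y)%N -> exists p,
  [/\ is_walk s y p, avoids F p & (path_cost p).+1 = dist L y].
Proof.
have [_ _ par] := tree_labelsP topo_l.
have walk_rcons x z p a : is_walk x z p -> src a = z ->
    is_walk x (tgt a) (rcons p a).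
  elim: p x => [|b p IHp] x /=; first by move/eqP-> => ->; rewrite !eqxx.
  by move=> /andP[-> /IHp walk_p] /walk_p.
have [n] := ubnP (r y); elim: n y => // n IH y lt_n Ly.
have [->|neq] := eqVneq y s.
  by exists [::]; rewrite /= eqxx dist_source /path_cost big_nil.
have [a [_ Ey _ aF [La Ea]]] := par y Ly neq.
have [|p [walk_p avoid_p cost_p]] := IH (src a) _ La.
  by have := inc a; rewrite Ey; lia.
exists (rcons p a); split; rewrite -?Ey; first exact: walk_rcons walk_p _.
  by rewrite /avoids all_rcons aF.
rewrite Ey Ea -cost_p /path_cost -cats1 big_cat /= big_seq1; lia.
Qed.

Lemma shortest_path_None t : dist L t = 0%N -> shortest_path F s t None.
Proof.
move=> Lt p; rewrite is_path_walk; apply/negP => /andP[walk_p avoid_p].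
by have := walk_dist walk_p avoid_p; rewrite Lt.
Qed.

Lemma shortest_path_Some t p : is_walk s t p -> avoids F p ->
  (path_cost p).+1 = dist L t -> shortest_path F s t (Some p).
Proof.
move=> walk_p avoid_p cost_p; split; first by rewrite is_path_walk walk_p.
move=> p'; rewrite is_path_walk => /andP[walk_p' avoid_p'].
by have := walk_dist walk_p' avoid_p'; rewrite -cost_p => /andP[_].
Qed.

End Tree.

(** The distance from s, truncated at D and equal to D at the vertices that are
    not reached, both shifted by one.  The truncation keeps the potential
    finite without adding a rise. *)
Lemma lower_bound_potential F s t (D : nat) :
  (forall p, is_path F s t p -> (D <= path_cost p)%N) ->
  exists2 p : V -> int, feasible (fun a => a \notin F) (@acost I) p
    & D%:Z <= p t - p s.
Proof.
move=> lowD; have [l topo_l full_l] := topological_order.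
pose L := tree_labels F s l.
exists (fun v => if dist L v == 0%N then D.+1%:Z else (minn (dist L v) D.+1)%:Z).
  have [_ slack _] := tree_labelsP F s topo_l.
  move=> a aF; have := slack a (full_l a) aF; rewrite /rise -/L.
  by case: eqP; case: eqP; lia.
have Ls : dist L s = 1%N by apply: dist_source.
rewrite Ls /=; case: (dist L t =P 0%N) => [_|/eqP]; first lia.
rewrite -lt0n => /(dist_attained topo_l)[p [walk_p avoid_p cost_p]].
have := lowD p; rewrite is_path_walk walk_p avoid_p -/L -cost_p => /(_ isT); lia.
Qed.

(** * Flows along paths *)

Definition path_flow p (a : A) : int := (count_mem a p)%:Z.

Lemma path_flow_mem x y p a : is_walk x y p -> path_flow p a = (a \in p)%:Z.
Proof. by move/walk_uniq=> uniq_p; rewrite /path_flow count_uniq_mem. Qed.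

Lemma path_flow_cons b p a : path_flow (b :: p) a = (a == b)%:Z + path_flow p a.
Proof. by rewrite /path_flow /= PoszD eq_sym. Qed.

Lemma path_flow_balance x y p v : is_walk x y p ->
  \sum_(a | src a == v) path_flow p a - \sum_(a | tgt a == v) path_flow p a
    = (v == x)%:Z - (v == y)%:Z.
Proof.
have single (P : pred A) b : \sum_(a | P a) (a == b)%:Z = (P b)%:Z.
  case Pb: (P b); first by rewrite (bigD1 b) //= eqxx big1 ?addr0 // => a /andP[_ /negPf->].
  by rewrite big1 // => a Pa; case: eqP => // E; rewrite -E Pa in Pb.
elim: p x => [|b p IH] x /=.
  by move/eqP->; rewrite !big1 ?subrr.
move=> /andP[/eqP<- /IH balance_p].
under eq_bigr do rewrite path_flow_cons.
under [X in _ - X]eq_bigr do rewrite path_flow_cons.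
rewrite !big_split /= !single eq_sym (eq_sym v).
rewrite (_ : forall a b c d : int, a + b - (c + d) = a - c + (b - d)); last by move=> *; ring.
rewrite balance_p (eq_sym v (tgt b)) (eq_sym (src b)); ring.
Qed.

Lemma path_flow_cost p : flow_cost (path_flow p) = (path_cost p)%:Z.
Proof.
elim: p => [|b p IH]; rewrite /flow_cost.
  by rewrite big1 /path_cost ?big_nil // => a _; rewrite mulr0.
under eq_bigr do rewrite path_flow_cons mulrDr.
rewrite big_split path_cost_cons PoszD -IH; congr (_ + _).
rewrite (bigD1 b) //= eqxx mulr1 big1 ?addr0 // => a /negPf->.
by rewrite mulr0.
Qed.


(** * The two-paths flow is optimal *)

Lemma balanceE (s t : V) l v : unique_source s -> unique_sink t ->
  balance l v = balance l s * ((v == s)%:Z - (v == t)%:Z).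
Proof.
move=> src_s snk_t.
have neq_st : t != s.
  by have := src_s l s; have := snk_t l s; rewrite eqxx eq_sym => <-; lia.
have b0 w : w != s -> w != t -> balance l w = 0.
  by rewrite -(src_s l) -(snk_t l); lia.
have bt : balance l t = - balance l s.
  have := balance_sum l; rewrite (bigD1 s) //= (bigD1 t) //= big1 ?addr0; first lia.
  by move=> w /andP[]; apply: b0.
have [->|neq_s] := eqVneq v s; first by rewrite eq_sym (negPf neq_st) subr0 mulr1.
have [->|neq_t] := eqVneq v t; first by rewrite bt sub0r mulrN1.
by rewrite b0 ?subrr ?mulr0.
Qed.

(** Summation by parts; only s and t have a nonzero balance. *)
Lemma flow_rise (s t : V) l (f : A -> int) (pot : V -> int) :
  unique_source s -> unique_sink t -> is_flow l f ->
  \sum_a f a * rise pot a = balance l s * (pot t - pot s).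
Proof.
move=> src_s snk_t [_ bal_f].
have by_vertex (h : A -> V) : \sum_a f a * pot (h a) = \sum_v pot v * \sum_(a | h a == v) f a.
  rewrite (partition_big h predT) //=; apply: eq_bigr => v _.
  by rewrite mulr_sumr; apply: eq_bigr => a /eqP->; rewrite mulrC.
rewrite /rise; under eq_bigr do rewrite mulrBr.
rewrite sumrB !by_vertex -sumrB.
under eq_bigr => v _ do rewrite -mulrBr -opprB bal_f (balanceE l v src_s snk_t) mulrN mulrC.
rewrite sumrN; under eq_bigr do rewrite -mulrA mulrBl.
rewrite -mulr_sumr sumrB.
have pick x : \sum_v (v == x)%:Z * pot v = pot x.
  rewrite (bigD1 x) //= eqxx mul1r big1 ?addr0 // => v /negPf->.
  by rewrite mul0r.
rewrite !pick; ring.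
Qed.

(** Weak duality for the certificate of [sp_certifiable]. *)
Lemma robust_cost_bound (s t : V) (D E : int) g :
  SP_digraph (igraph I) -> unique_source s -> unique_sink t -> sorted_scenarios s ->
  distance_bounds (fun a => a \in fixed I) (@acost I) s t D E ->
  robust_flow g -> forall l,
  (balance l s - balance ord0 s) * E + balance ord0 s * D <= flow_cost (g l).
Proof.
move=> [o [q sp]] src_s snk_t sorted_s bounds [flow_g same_g] l.
have [p [q' [cert leE leD]]] := sp_certifiable sp bounds.
have b0 : 0 < balance ord0 s by rewrite src_s.
have bl : balance ord0 s <= balance l s by apply: sorted_s.
have Ep := flow_rise p src_s snk_t (flow_g l).
have Eq := flow_rise q' src_s snk_t (flow_g ord0).
apply: le_trans (_ : \sum_a g l a * rise p a + \sum_a g ord0 a * rise q' a <= _).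
  rewrite Ep Eq.
  have := ler_wpM2l (_ : 0 <= balance l s - balance ord0 s) leE.
  have := ler_wpM2l (ltW b0) leD; rewrite subr_ge0 => h1 /(_ bl) h2; lia.
rewrite -big_split /=; apply: ler_sum => a _.
have [gl0 _] := flow_g l; have [g00 _] := flow_g ord0.
have := cert a; case: ifP => [fix_a | _].
  rewrite (same_g a fix_a l ord0) -mulrDr mulrC => le_c.
  exact: ler_wpM2r.
move=> [le_p le_q]; rewrite mulrC -[leRHS]addr0; apply: lerD.
  exact: ler_wpM2r.
exact: mulr_ge0_le0.
Qed.

Lemma robust_cost_le (f g : 'I_(last_scen I).+1 -> A -> int) :
  (forall l, flow_cost (f l) <= flow_cost (g l)) -> robust_cost f <= robust_cost g.
Proof.
move=> le_fg; have le_g l : flow_cost (g l) <= robust_cost g.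
  rewrite /robust_cost (bigD1 l) //= le_max lexx.
  by [].
rewrite /robust_cost; apply: (big_ind (fun z => z <= robust_cost g)).
- exact: le_trans (le_fg _) (le_g _).
- by move=> x y lex ley; rewrite ge_max lex.
- by move=> l _; apply: le_trans (le_fg _) (le_g _).
Qed.

Definition mem_path (a : A) (P : option (seq A)) : int := (on_path a P)%:Z.

(** The shape in which the program stores the flow: a constant and a coefficient
    in {0, 1} of the balance of s. *)
Lemma two_paths_flowE (s : V) pfree pfix l a :
  two_paths_flow s pfree pfix l a =
  (if cheaper pfix pfree
   then balance ord0 s * (mem_path a pfix - mem_path a pfree) else 0)
  + mem_path a pfree * balance l s.
Proof.
rewrite /two_paths_flow /mem_path.
by case: cheaper; case: (on_path a pfix); case: (on_path a pfree) => /=; ring.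
Qed.

(** The common form of all cases: m units are sent along p and the rest along q.
    The path q uses no fixed arc unless the rest is zero, and its cost is E
    unless the rest is zero, so one path can play both parts when the other is
    missing or not cheaper. *)
Lemma two_paths_optimal_gen (s t : V) (p q : seq A) (E : int)
    (f : 'I_(last_scen I).+1 -> A -> int) :
  SP_digraph (igraph I) -> unique_source s -> unique_sink t -> sorted_scenarios s ->
  is_walk s t p -> is_walk s t q ->
  (forall l a, f l a = balance ord0 s * path_flow p a
                     + (balance l s - balance ord0 s) * path_flow q a) ->
  (forall l a, a \in fixed I -> (balance l s - balance ord0 s) * path_flow q a = 0) ->
  distance_bounds (fun a => a \in fixed I) (@acost I) s t (path_cost p)%:Z E ->
  (forall l, (balance l s - balance ord0 s) * (path_cost q)%:Z =
             (balance l s - balance ord0 s) * E) ->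
  optimal_robust_flow f.
Proof.
move=> sp src_s snk_t sorted_s walk_p walk_q fE fixE bounds costE.
have b0 : 0 < balance ord0 s by rewrite src_s.
split.
  split=> [l|a fix_a l l']; last by rewrite !fE !fixE.
  split=> [a|v].
    by rewrite fE addr_ge0 ?mulr_ge0 ?subr_ge0 ?(ltW b0) //; apply: sorted_s.
  have fsum (P : pred A) : \sum_(a | P a) f l a
      = balance ord0 s * \sum_(a | P a) path_flow p a
        + (balance l s - balance ord0 s) * \sum_(a | P a) path_flow q a.
    by rewrite !mulr_sumr -big_split; apply: eq_bigr => a _; apply: fE.
  rewrite !fsum (balanceE l v src_s snk_t).
  rewrite (_ : forall a b x y z w : int, a * x + b * y - (a * z + b * w) =
    a * (x - z) + b * (y - w)); last by move=> *; ring.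
  by rewrite (path_flow_balance v walk_p) (path_flow_balance v walk_q); ring.
move=> g robust_g; apply: robust_cost_le => l.
apply: le_trans (robust_cost_bound sp src_s snk_t sorted_s bounds robust_g l).
rewrite -costE -!path_flow_cost /flow_cost !mulr_sumr -big_split /=.
rewrite le_eqVlt; apply/orP; left; apply/eqP/eq_bigr => a _; rewrite fE; ring.
Qed.

Lemma path_flow_mem_path s t p a : is_walk s t p -> mem_path a (Some p) = path_flow p a.
Proof. by move=> walk_p; rewrite (path_flow_mem a walk_p). Qed.

End Paths.

Theorem two_paths_optimal (I : instance) (s t : vertex (igraph I)) :
  SP_digraph (igraph I) -> unique_source s -> unique_sink t -> sorted_scenarios s ->
  forall pfree pfix : option (seq (arc_of (igraph I))),
    shortest_path (fixed I) s t pfree -> shortest_path set0 s t pfix ->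
    pfree != None \/ (exists f, @robust_flow I f) ->
    optimal_robust_flow (two_paths_flow s pfree pfix).
Proof.
move=> sp src_s snk_t sorted_s; have [o [q sp_oq]] := sp.
have [r [_ _ _ inc]] := sp_rank sp_oq; rewrite /= in r inc.
have walkE F := is_path_walk inc F.
have subpath x y p : is_path (fixed I) x y p -> is_path set0 x y p.
  by rewrite !walkE => /andP[-> _]; apply/allP => a _; rewrite inE.
have bound F (D : nat) : (forall p, is_path F s t p -> (D <= path_cost p)%N) ->
    forall P : pred (arc_of (igraph I)), (forall a, P a -> a \notin F) ->
    exists2 p, feasible P (@acost I) p & D%:Z <= p t - p s.
  move=> /(lower_bound_potential inc)[p fp le_p] P PF.
  by exists p => // a /PF; apply: fp.
have b0 : 0 < balance ord0 s by rewrite src_s.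
move=> [pf|] [px|].
- move=> [path_f min_f] [path_x min_x] _.
  have := path_f; rewrite walkE => /andP[walk_f avoid_f].
  have := path_x; rewrite walkE => /andP[walk_x _].
  have le_xf := min_x _ (subpath _ _ _ path_f).
  have no_fix l a : a \in fixed I -> (balance l s - balance ord0 s) * path_flow pf a = 0.
    move=> fix_a; rewrite (path_flow_mem inc a walk_f).
    case pa: (a \in pf); last by rewrite mulr0.
    by have /allP/(_ a pa) := avoid_f; rewrite fix_a.
  case cheap: (cheaper (Some px) (Some pf)).
    apply: (two_paths_optimal_gen (p := px) (q := pf) (E := (path_cost pf)%:Z)) => //.
      move=> l a; rewrite two_paths_flowE cheap !(path_flow_mem_path inc (s := s) (t := t)) //.
      ring.
    split; first lia.
      by apply: (bound set0) => // a _; rewrite inE.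
    exact: (bound (fixed I)).
  have eq_xf : path_cost px = path_cost pf by move: cheap => /=; lia.
  apply: (two_paths_optimal_gen (p := pf) (q := pf) (E := (path_cost pf)%:Z)) => //.
    move=> l a; rewrite two_paths_flowE cheap !(path_flow_mem_path inc (s := s) (t := t)) //.
    ring.
  split=> //.
    by apply: (bound set0) => [|a _]; rewrite ?inE // -eq_xf.
  exact: (bound (fixed I)).
- move=> [path_f _] none_x _.
  by have := none_x pf; rewrite subpath.
- move=> none_f [path_x min_x] [//|[g robust_g]].
  have := path_x; rewrite walkE => /andP[walk_x _].
  have bounds (E : nat) : (path_cost px <= E)%N ->
      distance_bounds (fun a => a \in fixed I) (@acost I) s t (path_cost px)%:Z E%:Z.
    move=> leE; split=> //.
      by apply: (bound set0) => // a _; rewrite inE.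
    by apply: (bound (fixed I)) => // p path_p; have := none_f p; rewrite path_p.
  have constant l : balance l s = balance ord0 s.
    have cost_bound E leE :=
      robust_cost_bound sp src_s snk_t sorted_s (bounds E leE) robust_g l.
    have le_b : balance ord0 s <= balance l s by apply: sorted_s.
    apply/eqP; move: le_b; rewrite le_eqVlt eq_sym => /orP[//|lt_b].
    (* A positive surplus would cost more than g l in total. *)
    have := cost_bound (path_cost px + `|flow_cost (g l)|.+1)%N (leq_addr _ _).
    nia.
  apply: (two_paths_optimal_gen (p := px) (q := px) (E := (path_cost px)%:Z)) => //.
  + move=> l a; rewrite two_paths_flowE /= (path_flow_mem_path inc a walk_x).
    by rewrite constant /mem_path /=; ring.
  + by move=> l a _; rewrite constant subrr mul0r.
  + exact: bounds.
- move=> none_f none_x [//|[g robust_g]].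
  have bounds (E : nat) :
      distance_bounds (fun a => a \in fixed I) (@acost I) s t E%:Z E%:Z.
    split=> //.
      apply: (bound set0) => [p path_p|a _]; last by rewrite inE.
      by have := none_x p; rewrite path_p.
    by apply: (bound (fixed I)) => // p path_p; have := none_f p; rewrite path_p.
  have := robust_cost_bound sp src_s snk_t sorted_s
    (bounds `|flow_cost (g ord0)|.+1) robust_g ord0.
  nia.
Qed.

(** * A program logic with running times *)

Fixpoint loop_free (c : cmd) : bool :=
  match c with
  | Seq c1 c2 | If _ c1 c2 => loop_free c1 && loop_free c2
  | While _ _ => false
  | _ => true
  end.

(** The final state of a loop-free program, as a function that computes on an
    explicit program. *)
Fixpoint post (c : cmd) (st : state) : state :=
  match c with
  | Skip | While _ _ => st
  | SetReg x e => set_reg st x (eval st e)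
  | SetCell k e1 e2 => set_cell st k (eval st e1) (eval st e2)
  | Seq c1 c2 => post c2 (post c1 st)
  | If b c1 c2 => if holds st b then post c1 st else post c2 st
  end.

Fixpoint max_time (c : cmd) : nat :=
  match c with
  | Skip | While _ _ => 1
  | SetReg x e => (expr_time e).+1
  | SetCell k e1 e2 => (expr_time e1 + expr_time e2).+1
  | Seq c1 c2 => max_time c1 + max_time c2
  | If b c1 c2 => (test_time b + (max_time c1 + max_time c2)).+1
  end.

Fixpoint writes_reg (x : nat) (c : cmd) : bool :=
  match c with
  | SetReg y _ => x == y
  | Seq c1 c2 | If _ c1 c2 => writes_reg x c1 || writes_reg x c2
  | While _ c => writes_reg x c
  | _ => false
  end.

Fixpoint writes_cell (k : nat) (c : cmd) : bool :=
  match c with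
  | SetCell k' _ _ => k == k'
  | Seq c1 c2 | If _ c1 c2 => writes_cell k c1 || writes_cell k c2
  | While _ c => writes_cell k c
  | _ => false
  end.

(** Syntactic frame: memory that the text of c never writes keeps its value. *)
Definition framed (c : cmd) (st st' : state) : Prop :=
  (forall x, ~~ writes_reg x c -> reg st' x = reg st x) /\
  (forall k, ~~ writes_cell k c -> cell st' k =1 cell st k).

Definition run (c : cmd) (st : state) (n : nat) (Q : state -> Prop) : Prop :=
  exists n' st', [/\ exec c st n' st', (n' <= n)%N & Q st'].

Lemma framed_trans c st1 st2 st3 :
  framed c st1 st2 -> framed c st2 st3 -> framed c st1 st3.
Proof.
move=> [r12 c12] [r23 c23]; split=> [x nx|k nk z]; first by rewrite r23 ?r12.
by rewrite c23 ?c12.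
Qed.

Lemma framed_sub c c' st st' :
  (forall x, writes_reg x c -> writes_reg x c') ->
  (forall k, writes_cell k c -> writes_cell k c') ->
  framed c st st' -> framed c' st st'.
Proof.
move=> subr subc [fr fc]; split=> [x nx|k nk]; first exact/fr/contraNN/nx/subr.
exact/fc/contraNN/nk/subc.
Qed.

Lemma exec_framed c st n st' : exec c st n st' -> framed c st st'.
Proof.
elim=> {c st n st'} //=.
- by move=> st x e; split=> //= y /negPf->.
- by move=> st k e1 e2; split=> //= k' /negPf-> i.
- move=> c1 c2 st n1 st1 n2 st2 _ f1 _ f2; apply: (@framed_trans _ _ st1).
    by apply: framed_sub f1 => x /= ->.
  by apply: framed_sub f2 => x /= ->; rewrite orbT.
- move=> b c1 c2 st n st' _; case: (holds st b) => f; apply: framed_sub f => x /= ->;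
    by rewrite ?orbT.
- by move=> b c st n1 st1 n2 st2 _ _ f1 _ f2; apply: framed_trans f2.
Qed.

Lemma run_framed c st n Q :
  run c st n Q -> run c st n (fun st' => framed c st st' /\ Q st').
Proof.
move=> [n' [st' [ex le_n Qst]]]; exists n', st'; split=> //.
by split=> //; apply: exec_framed ex.
Qed.

(** All time bounds are multiples of one input size N, so that the factors of
    consecutive programs add up. *)
Lemma run_seq c1 c2 st k1 k2 N (Q1 Q2 : state -> Prop) :
  run c1 st (k1 * N) Q1 ->
  (forall st1, framed c1 st st1 -> Q1 st1 -> run c2 st1 (k2 * N) Q2) ->
  run (Seq c1 c2) st ((k1 + k2) * N) Q2.
Proof.
move=> /run_framed[m1 [st1 [ex1 le1 [fr1 Qst1]]]] /(_ st1 fr1 Qst1)[m2 [st2 [ex2 le2 Qst2]]].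
exists (m1 + m2)%N, st2; split=> //; first exact: exec_seq ex1 ex2.
by rewrite mulnDl leq_add.
Qed.

Lemma exec_post c st : loop_free c ->
  exists2 n, exec c st n (post c st) & (n <= max_time c)%N.
Proof.
elim: c st => //= [st _|x e st _|k e1 e2 st _|c1 IH1 c2 IH2 st|b c1 IH1 c2 IH2 st].
- by exists 1%N => //; constructor.
- by exists (expr_time e).+1 => //; constructor.
- by exists (expr_time e1 + expr_time e2).+1 => //; constructor.
- move=> /andP[free1 free2]; have [n1 ex1 le1] := IH1 st free1.
  have [n2 ex2 le2] := IH2 (post c1 st) free2.
  by exists (n1 + n2)%N; [apply: exec_seq ex1 ex2 | apply: leq_add].
- move=> /andP[free1 free2]; have [n1 ex1 le1] := IH1 st free1.
  have [n2 ex2 le2] := IH2 st free2.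
  case b_st: (holds st b).
    exists (test_time b + n1).+1; last by rewrite ltnS leq_add2l (leq_trans le1) ?leq_addr.
    by apply: exec_if; rewrite b_st.
  exists (test_time b + n2).+1; last by rewrite ltnS leq_add2l (leq_trans le2) ?leq_addl.
  by apply: exec_if; rewrite b_st.
Qed.

Lemma run_post c st N : loop_free c -> (0 < N)%N ->
  run c st (max_time c * N) (eq (post c st)).
Proof.
move=> free_c N0; have [n ex_c le_n] := exec_post st free_c.
by exists n, (post c st); split=> //; apply: leq_trans le_n (leq_pmulr _ N0).
Qed.

Definition loop_time b c := ((test_time b).+1 + max_time c)%N.

(** The natural number in the invariant is a variant that decreases in each
    round. *)
Lemma run_while b c st0 (Inv : nat -> state -> Prop) k0 n (Q : state -> Prop) :
  loop_free c -> Inv k0 st0 -> (k0.+1 * loop_time b c <= n)%N ->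
  (forall k st, framed c st0 st -> Inv k st -> holds st b ->
     exists2 k', (k' < k)%N & Inv k' (post c st)) ->
  (forall k st, framed c st0 st -> Inv k st -> ~~ holds st b -> Q st) ->
  run (While b c) st0 n Q.
Proof.
move=> free_c Inv0 le_n step done.
suff main k st : framed c st0 st -> Inv k st ->
    run (While b c) st (k.+1 * loop_time b c) Q.
  have [n' [st' [ex_c le_n' Qst]]] := main k0 st0 (conj (fun _ _ => erefl) (fun _ _ _ => erefl)) Inv0.
  by exists n', st'; split=> //; apply: leq_trans le_n.
have [m] := ubnP k; elim: m k st => // m IH k st lt_km fr Inv_st.
have [b_st|nb_st] := boolP (holds st b); last first.
  exists (test_time b).+1, st; split; [exact: exec_while_done | | exact: done Inv_st nb_st].
  by rewrite /loop_time mulSn -addnA leq_addr.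
have [k' lt_k Inv'] := step k st fr Inv_st b_st.
have [n1 ex1 le1] := exec_post st free_c.
have [|n2 [st2 [ex2 le2 Q2]]] := IH k' _ (leq_trans lt_k lt_km) _ Inv'.
  exact: framed_trans fr (exec_framed ex1).
exists ((test_time b).+1 + n1 + n2)%N, st2; split=> //; first exact: exec_while_step ex1 ex2.
rewrite mulSn leq_add // ?leq_add2l // (leq_trans le2) // leq_mul2r.
by rewrite lt_k orbT.
Qed.

Definition loop_cost c0 b c := (max_time c0 + 2 * loop_time b c)%N.

(** The factor 2 pays for the rounds, at most N, and for the last test, at most N
    more since N is positive. *)
Lemma run_loop c0 b c st0 (Inv : nat -> state -> Prop) k0 N (Q : state -> Prop) :
  loop_free c0 -> loop_free c -> (0 < N)%N -> (k0 <= N)%N -> Inv k0 (post c0 st0) ->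
  (forall k st, framed (Seq c0 (While b c)) st0 st -> Inv k st -> holds st b ->
     exists2 k', (k' < k)%N & Inv k' (post c st)) ->
  (forall k st, framed (Seq c0 (While b c)) st0 st -> Inv k st -> ~~ holds st b -> Q st) ->
  run (Seq c0 (While b c)) st0 (loop_cost c0 b c * N) Q.
Proof.
move=> free0 free_c N0 le_k Inv0 step done.
have [n1 ex1 le1] := exec_post st0 free0.
have fr st : framed c (post c0 st0) st -> framed (Seq c0 (While b c)) st0 st.
  move=> fr2; apply: (@framed_trans _ _ (post c0 st0)).
    by apply: framed_sub (exec_framed ex1) => x /= ->.
  by apply: framed_sub fr2 => x /= ->; rewrite orbT.
have [|n2 [st2 [ex2 le2 Q2]]] := run_while (b := b) (n := (2 * loop_time b c * N)%N) (Q := Q)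
    free_c Inv0 _ (fun k st f => step k st (fr st f)) (fun k st f => done k st (fr st f)).
  by rewrite [leqRHS]mulnAC leq_mul2r; apply/orP; right; lia.
exists (n1 + n2)%N, st2; split=> //; first exact: exec_seq ex1 ex2.
by rewrite /loop_cost mulnDl leq_add // (leq_trans le1) // leq_pmulr.
Qed.

(** * Memory contents *)

Lemma nth_allpairs (S T R : Type) (f : S -> T -> R) z0 x0 y0 (xs : seq S) (ys : seq T) i j :
  (i < size xs)%N -> (j < size ys)%N ->
  nth z0 [seq f x y | x <- xs, y <- ys] (i * size ys + j) = f (nth x0 xs i) (nth y0 ys j).
Proof.
move=> + lt_j; elim: xs i => //= x xs IH [|i] lt_i.
  by rewrite nth_cat size_map lt_j (nth_map y0).
by rewrite nth_cat size_map mulSn -addnA ltnNge leq_addr /= addKn IH.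
Qed.

Lemma enum_rank_split (T : finType) (l l' : seq T) x :
  enum T = l ++ x :: l' -> enum_rank x = size l :> nat.
Proof.
move=> E; have lt_l : (size l < size (enum T))%N by rewrite E size_cat addnS ltnS leq_addr.
apply/eqP; rewrite -(nth_uniq x _ lt_l (enum_uniq T)); last by rewrite -cardE.
by rewrite nth_enum_rank E nth_cat ltnn subnn.
Qed.

Definition stores (st : state) (k : nat) (l : seq int) : Prop :=
  forall j, (j < size l)%N -> cell st k j%:Z = nth 0 l j.

Lemma stores_eq st st' k l : cell st' k =1 cell st k -> stores st k l -> stores st' k l.
Proof. by move=> eq_k st_l j lt_j; rewrite eq_k st_l. Qed.

Lemma stores_rcons st st' k l z :
  (forall i, cell st' k i = if i == (size l)%:Z then z else cell st k i) ->
  stores st k l -> stores st' k (rcons l z).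
Proof.
move=> cell_k st_l j; rewrite size_rcons ltnS leq_eqVlt cell_k nth_rcons.
case: (ltngtP j (size l)) => //= [lt_j _|-> _]; last by rewrite eqxx.
by rewrite st_l //; case: eqP => // -[E]; rewrite E ltnn in lt_j.
Qed.

Section Encoding.
Variables (I : instance) (s t : vertex (igraph I)).
Local Notation V := (vertex (igraph I)).
Local Notation A := (arc_of (igraph I)).
Implicit Types (a : A) (v : V) (st : state).

Definition vnum v : int := (enum_rank v : nat)%:Z.
Definition anum a : int := (enum_rank a : nat)%:Z.

Lemma eq_vnum v w : (vnum v == vnum w) = (v == w).
Proof. by rewrite /vnum eqz_nat -(inj_eq enum_rank_inj) -val_eqE. Qed.

Lemma eq_anum a b : (anum a == anum b) = (a == b).
Proof. by rewrite /anum eqz_nat -(inj_eq enum_rank_inj) -val_eqE. Qed.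

Definition has_input st : Prop :=
  [/\ reg st 0 = #|V|%:Z, reg st 1 = #|A|%:Z, reg st 2 = vnum s, reg st 3 = vnum t
    & reg st 4 = (last_scen I).+1%:Z] /\
  [/\ forall a, cell st 0 (anum a) = vnum (src a),
      forall a, cell st 1 (anum a) = vnum (tgt a),
      forall a, cell st 2 (anum a) = (acost a)%:Z,
      forall a, cell st 3 (anum a) = (a \in fixed I : nat)%:Z
    & forall (l : 'I_(last_scen I).+1) v,
        cell st 4 (l * #|V| + enum_rank v)%N%:Z = balance l v].

Lemma encode_input : has_input (encode s t).
Proof.
have nth_arc (f : A -> int) a : nth 0 [seq f b | b <- enum A] (enum_rank a) = f a.
  by rewrite (nth_map a) ?nth_enum_rank // -cardE.
split; split=> // [a|a|a|a|l v]; try exact: nth_arc.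
have := nth_allpairs (@balance I) 0 l v (i := l) (j := enum_rank v)
  (xs := enum 'I_(last_scen I).+1) (ys := enum V).
by rewrite size_enum_ord -cardE nth_ord_enum nth_enum_rank; apply.
Qed.

Lemma encode_blank k : (4 < k)%N -> cell (encode s t) k =1 (fun=> 0).
Proof. by case: k => [|[|[|[|[|k]]]]] // _ [j|j] //=; rewrite !nth_nil. Qed.

Definition spares_input c :=
  all (fun x => ~~ writes_reg x c && ~~ writes_cell x c) (iota 0 5).

Lemma input_framed c st st' :
  framed c st st' -> spares_input c -> has_input st -> has_input st'.
Proof.
move=> [fr fc] /and5P[/andP[r0 c0] /andP[r1 c1] /andP[r2 c2] /andP[r3 c3] /andP[/andP[r4 c4] _]].
move=> [[h0 h1 h2 h3 h4] [k0 k1 k2 k3 k4]]; split; first by split; rewrite fr.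
by split=> *; rewrite fc.
Qed.

(** A linked list of arcs as the program stores it: a pointer is the number of an
    arc plus one, and 0 is the null pointer, so that blank memory holds empty
    lists. *)
Fixpoint chain (next : int -> int) (e : int) (l : seq A) : Prop :=
  if l is a :: l' then e = anum a + 1 /\ chain next (next (anum a)) l' else e = 0.

Lemma chain_eq (next next' : int -> int) e l :
  (forall a, a \in l -> next' (anum a) = next (anum a)) ->
  chain next e l -> chain next' e l.
Proof.
elim: l e => //= a l IH e same [-> chain_l]; split=> //.
rewrite same ?mem_head //; apply: IH chain_l => b bl.
by rewrite same // inE bl orbT.
Qed.

End Encoding.

(** * Reading the arcs *)

Local Notation R := Reg.
Local Notation "n %:L" := (Lit n%:Z) (at level 2, format "n %:L").
Local Notation "c ;; d" := (Seq c d) (at level 80, right associativity).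

Definition incr x := SetReg x (Plus (R x) 1%:L).

(** The memory beyond the input is used as follows.
    - Registers: 5 is a loop counter, 6 the length of the vertex queue, 7 the
      position of its first element, 8 a pointer into the list of out-arcs of the
      current vertex, 9 the number of sorted arcs, 10 the current arc, 11 the flow
      sent along the path that may use fixed arcs, 12 the current vertex of a
      traced path, 13 and 14 the amounts that a traced path adds to arrays 5 and 6.
      [expand] uses 5 for the scenario, 6 for the arc, 7 for the output position
      and 8 for the index of the balance of s.
    - Arrays: 8 holds the indegrees that remain, 9 the heads of the lists of
      out-arcs, 10 the next arc in such a list, 11 the vertex queue, 12 the
      sorted arcs, 13 and 14 the distances and parent arcs in the graph of the
      free arcs, 15 and 16 those in the whole graph. *)
Definition read_arcs_step :=
  SetCell 8 (Cell 1 (R 5)) (Plus (Cell 8 (Cell 1 (R 5))) 1%:L) ;;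
  SetCell 10 (R 5) (Cell 9 (Cell 0 (R 5))) ;;
  SetCell 9 (Cell 0 (R 5)) (Plus (R 5) 1%:L) ;;
  incr 5.

Definition read_arcs :=
  SetReg 5 0%:L ;; While (Not (Leq (R 1) (R 5))) read_arcs_step.

Definition read_arcs_time :=
  loop_cost (SetReg 5 0%:L) (Not (Leq (R 1) (R 5))) read_arcs_step.

Section Reading.
Variables (I : instance) (s t : vertex (igraph I)).
Local Notation V := (vertex (igraph I)).
Local Notation A := (arc_of (igraph I)).
Implicit Types (a : A) (v : V) (st : state).
Let N := (#|V| + #|A|)%N.

Lemma input_size_gt0 : (0 < N)%N.
Proof. by rewrite addn_gt0; apply/orP; left; apply/card_gt0P; exists s. Qed.

Definition adjacency st (outs : V -> seq A) : Prop :=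
  [/\ forall v, chain (cell st 10) (cell st 9 (vnum v)) (outs v), forall v, uniq (outs v)
    & forall v a, (a \in outs v) = (src a == v)].

Definition indegree (l : seq A) v := #|[set a | (tgt a == v) && (a \notin l)]|.

Lemma run_read_arcs st0 : has_input s t st0 ->
  (forall k, (4 < k)%N -> cell st0 k =1 (fun=> 0)) ->
  run read_arcs st0 (read_arcs_time * N) (fun st =>
    (exists outs, adjacency st outs) /\
    forall v, cell st 8 (vnum v) = (indegree [::] v)%:Z).
Proof.
move=> in0 blank; have N0 := input_size_gt0.
pose outs (l : seq A) v := [seq a <- rev l | src a == v].
apply: (@run_loop _ _ _ _ (fun k st => exists l l', [/\ enum A = l ++ l',
   k = size l', reg st 5 = (size l)%:Z,
   forall v, chain (cell st 10) (cell st 9 (vnum v)) (outs l v)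
   & forall v, cell st 8 (vnum v) = (count (fun a => tgt a == v) l)%:Z]) #|A|) => //.
- exact: leq_addl.
- exists [::], (enum A); rewrite -cardE; split=> // v /=; exact: blank.
- move=> k st fr [l [[|a l'] [E -> i_st chain_st deg_st]]];
    have [[_ nA _ _ _] [st0E st1E _ _ _]] := input_framed fr isT in0.
    by rewrite /= i_st nA (cardE A) E cats0 lexx.
  have {}i_st : reg st 5 = anum a by rewrite i_st /anum (enum_rank_split E).
  move=> _; exists (size l'); first exact: ltnSn.
  exists (rcons l a), l'; split=> //; first by rewrite cat_rcons.
  + by rewrite /= i_st /anum (enum_rank_split E) size_rcons; lia.
  + move=> v; rewrite /outs rev_rcons /= !i_st st0E eq_vnum eq_sym.
    have fresh b : b \in outs l v -> anum b == anum a = false.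
      rewrite mem_filter mem_rev eq_anum => /andP[_ bl]; apply/eqP => Eb.
      by have := enum_uniq A; rewrite E -Eb cat_uniq /= bl andbF.
    case: eqP => [Ev|_]; last by apply: chain_eq (chain_st v) => b /fresh ->.
    by split; rewrite // eqxx Ev; apply: chain_eq (chain_st v) => b /fresh ->.
  + move=> v; rewrite /= !i_st st1E eq_vnum deg_st -cats1 count_cat /= addn0 eq_sym.
    by case: eqP => [->|_]; rewrite ?addn0 ?deg_st; lia.
- move=> k st fr [l [l' [E _ i_st chain_st deg_st]]].
  have [[_ nA _ _ _] _] := input_framed fr isT in0.
  rewrite /= i_st nA negbK cardE E size_cat lez_nat -[X in (_ <= X)%N]addn0 leq_add2l leqn0.
  move=> /nilP El'; rewrite El' cats0 in E; split.
    exists (outs l); split=> // v; first by rewrite filter_uniq // rev_uniq -E enum_uniq.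
    by move=> a; rewrite mem_filter mem_rev -E mem_enum andbT.
  move=> v; rewrite deg_st -E /indegree cardE enumT /enum_mem size_filter; congr (_%:Z).
 by apply: eq_count => a; rewrite /= inE andbT.
Qed.

End Reading.

(** * Topological sorting of the arcs *)

Definition find_sources_step :=
  If (Equal (Cell 8 (R 5)) 0%:L) (SetCell 11 (R 6) (R 5) ;; incr 6) Skip ;;
  incr 5.
Definition find_sources_init := SetReg 5 0%:L ;; SetReg 6 0%:L.
Definition find_sources :=
  find_sources_init ;; While (Not (Leq (R 0) (R 5))) find_sources_step.
Definition find_sources_time :=
  loop_cost find_sources_init (Not (Leq (R 0) (R 5))) find_sources_step.

(** Kahn's algorithm with its two nested loops flattened: a round either takes the
    next vertex from the queue or handles one out-arc of the current vertex. *)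
Definition sort_arcs_step :=
  If (Equal (R 8) 0%:L)
    (SetReg 8 (Cell 9 (Cell 11 (R 7))) ;; incr 7)
    (SetReg 10 (Minus (R 8) 1%:L) ;;
     SetCell 12 (R 9) (R 10) ;;
     incr 9 ;;
     SetReg 8 (Cell 10 (R 10)) ;;
     SetCell 8 (Cell 1 (R 10)) (Minus (Cell 8 (Cell 1 (R 10))) 1%:L) ;;
     If (Equal (Cell 8 (Cell 1 (R 10))) 0%:L)
       (SetCell 11 (R 6) (Cell 1 (R 10)) ;; incr 6) Skip).
Definition sort_arcs_init := SetReg 7 0%:L ;; SetReg 8 0%:L ;; SetReg 9 0%:L.
(** Both summands are nonnegative, so their sum is 0 exactly when the list and the
    queue are exhausted. *)
Definition sort_arcs_test := Not (Equal (Plus (R 8) (Minus (R 6) (R 7))) 0%:L).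
Definition sort_arcs := sort_arcs_init ;; While sort_arcs_test sort_arcs_step.
Definition sort_arcs_time := loop_cost sort_arcs_init sort_arcs_test sort_arcs_step.

Section Sorting.
Variables (I : instance) (s t : vertex (igraph I)).
Local Notation V := (vertex (igraph I)).
Local Notation A := (arc_of (igraph I)).
Implicit Types (a : A) (v : V) (st : state).
Let N := (#|V| + #|A|)%N.

Lemma run_find_sources st0 : has_input s t st0 ->
  (forall v, cell st0 8 (vnum v) = (indegree [::] v)%:Z) ->
  run find_sources st0 (find_sources_time * N) (fun st => exists qs : seq V,
    [/\ uniq qs, forall v, (v \in qs) = (indegree [::] v == 0%N),
        stores st 11 (map (@vnum I) qs) & reg st 6 = (size qs)%:Z]).
Proof.
move=> in0 deg0; have N0 := input_size_gt0 s.
pose qs (l : seq V) := [seq v <- l | indegree [::] v == 0%N].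
apply: (@run_loop _ _ _ _ (fun k st => exists l l', [/\ enum V = l ++ l',
   k = size l', reg st 5 = (size l)%:Z, stores st 11 (map (@vnum I) (qs l))
   & reg st 6 = (size (qs l))%:Z]) #|V|) => //.
- exact: leq_addr.
- by exists [::], (enum V); rewrite -cardE; split.
- move=> k st fr [l [[|v l'] [E -> i_st q_st len_st]]];
    have [[nV _ _ _ _] _] := input_framed fr isT in0.
    by rewrite /= i_st nV (cardE V) E cats0 lexx.
  have {}i_st : reg st 5 = vnum v by rewrite i_st /vnum (enum_rank_split E).
  have Ev : size l = enum_rank v by rewrite (enum_rank_split E).
  move=> _; exists (size l'); first exact: ltnSn.
  exists (rcons l v), l'; rewrite cat_rcons size_rcons /qs filter_rcons.
  have -> : post find_sources_step st = if indegree [::] v == 0%N then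
      post (SetCell 11 (R 6) (R 5) ;; incr 6 ;; incr 5) st else post (incr 5) st.
    by rewrite /= i_st fr.2 // deg0 eqz_nat; case: ifP => //= _; rewrite i_st.
  case: ifP => _; split=> //=.
  + by rewrite i_st /vnum -Ev; lia.
  + by rewrite map_rcons; apply: stores_rcons q_st => i /=; rewrite len_st size_map i_st.
  + by rewrite size_rcons len_st /qs; lia.
  + by rewrite i_st /vnum -Ev; lia.
- move=> k st fr [l [l' [E _ i_st q_st len_st]]].
  have [[nV _ _ _ _] _] := input_framed fr isT in0.
  rewrite /= i_st nV negbK cardE E size_cat lez_nat -[X in (_ <= X)%N]addn0 leq_add2l leqn0.
  move=> /nilP El'; rewrite El' cats0 in E; exists (qs l); split=> //.
    by rewrite filter_uniq // -E enum_uniq.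
  by move=> v; rewrite mem_filter -E mem_enum andbT.
Qed.

Lemma indegree_rcons (l : seq A) a v : a \notin l ->
  indegree l v = ((tgt a == v) + indegree (rcons l a) v)%N.
Proof.
move=> al; rewrite /indegree (cardsD1 a [set b | _ & b \notin l]) inE al andbT.
congr (_ + _)%N; apply: eq_card => b; rewrite !inE mem_rcons inE negb_or.
by case: (b == a); rewrite ?andbF ?andbT.
Qed.

Lemma indegree0 (l : seq A) v :
  reflect (forall a, tgt a = v -> a \in l) (indegree l v == 0%N).
Proof.
rewrite cards_eq0; apply: (iffP eqP) => [E a Ea | all_in].
  by apply: contraT => al; have := in_set0 a; rewrite -E inE Ea eqxx al.
by apply/setP => a; rewrite !inE; case: eqP => // /all_in ->.
Qed.

Variable r : V -> nat.
Hypothesis inc : forall a : A, (r (src a) < r (tgt a))%N.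

(** Here qs is the list of all vertices ever queued, of which the first qh have
    been taken out, od the sorted arcs, and rem the out-arcs of the current
    vertex still to be handled. *)
Definition sorting_state st (qs : seq V) (qh : nat) (od rem : seq A) : Prop :=
  [/\ uniq qs, uniq (od ++ rem), topological od,
      forall a, (a \in od ++ rem) = (src a \in take qh qs)
    & forall v, (v \in qs) = (indegree od v == 0%N)] /\
  [/\ stores st 11 (map (@vnum I) qs), reg st 6 = (size qs)%:Z, reg st 7 = qh%:Z
    & (qh <= size qs)%N] /\
  [/\ stores st 12 (map (@anum I) od), reg st 9 = (size od)%:Z,
      chain (cell st 10) (reg st 8) rem
    & forall v, cell st 8 (vnum v) = (indegree od v)%:Z].

(** The variant counts the vertices not yet taken out and the arcs not yet sorted.
    At the end every vertex has been queued, by induction on its rank: the tails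
    of the arcs into it have been taken out, hence these arcs are sorted. *)
Lemma run_sort_arcs st0 (outs : V -> seq A) qs0 : has_input s t st0 -> adjacency st0 outs ->
  (forall v, cell st0 8 (vnum v) = (indegree [::] v)%:Z) ->
  uniq qs0 -> (forall v, (v \in qs0) = (indegree [::] v == 0%N)) ->
  stores st0 11 (map (@vnum I) qs0) -> reg st0 6 = (size qs0)%:Z ->
  run sort_arcs st0 (sort_arcs_time * N) (fun st => exists od : seq A,
    [/\ topological od, size od = #|A|, forall a, a \in od
      & stores st 12 (map (@anum I) od)]).
Proof.
move=> in0 [head_st uniq_outs outsP] deg0 uniq0 src0 q0 len0.
have N0 := input_size_gt0 s.
apply: (@run_loop _ _ _ _ (fun k st => exists qs qh od rem,
   sorting_state st qs qh od rem /\ k = (#|V| - qh + (#|A| - size od))%N) N) => //.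
- exists qs0, 0%N, [::], [::]; split; last by rewrite !subn0.
  by split; split=> // a; rewrite take0.
- move=> k st fr [qs [qh [od [rem [[[uqs uod topo_od odE qsE] [[q_st len_st qh_st le_qh]
    [od_st cnt_st e_st deg_st]]] ->]]]]].
  have [_ [st0E st1E _ _ _]] := input_framed fr isT in0.
  case: rem => [|a rem] in uod odE e_st *.
    rewrite /= e_st => more.
    have lt_qh : (qh < size qs)%N by move: more; rewrite len_st qh_st; lia.
    have {}Eh : forall v0, cell st 11 qh = vnum (nth v0 qs qh).
      by move=> v0; rewrite q_st ?size_map // (nth_map v0).
    have le_V : (size qs <= #|V|)%N by rewrite -(card_uniqP uqs) max_card.
    case Ev: (drop qh qs) => [|v qs']; first by have := size_drop qh qs; rewrite Ev /=; lia.
    have Etake : take qh.+1 qs = rcons (take qh qs) v.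
      by rewrite (take_nth v lt_qh) -[X in nth v qs X]addn0 -nth_drop Ev.
    have vE : nth v qs qh = v by rewrite -[X in nth v qs X]addn0 -nth_drop Ev.
    have v_new : v \notin take qh qs.
      by have := take_uniq qh.+1 uqs; rewrite Etake rcons_uniq => /andP[].
    exists (#|V| - qh.+1 + (#|A| - size od))%N.
      by rewrite ltn_add2r ltn_sub2l // (leq_trans lt_qh).
    exists qs, qh.+1, od, (outs v); split=> //.
    split; [split=> // | split; split=> //=].
    + rewrite cats0 in uod; rewrite cat_uniq uod uniq_outs andbT /=.
      apply/hasPn => a; rewrite outsP => /eqP Ea; have := odE a.
      by rewrite cats0 Ea (negPf v_new) => ->.
    + move=> a; have := odE a; rewrite cats0 mem_cat => ->.
      by rewrite outsP Etake mem_rcons inE orbC.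
    + by rewrite qh_st; lia.
    + rewrite qh_st (Eh v) vE; have := head_st v.
      rewrite fr.2 //; apply: chain_eq => b _; exact: fr.2.
  move=> _; have [Ea chain_rem] := e_st.
  have a_od : a \notin od.
    by move: uod; rewrite cat_uniq /= negb_or => /and3P[_ /andP[]].
  have lt_od : (size od < #|A|)%N.
    have := max_card (mem (od ++ a :: rem)); rewrite (card_uniqP uod) size_cat /=; lia.
  exists (#|V| - qh + (#|A| - (size od).+1))%N.
    by rewrite ltn_add2l ltn_sub2l.
  have Ea' : reg st 8 - 1%:Z = anum a by rewrite Ea; lia.
  have nz : (reg st 8 == 0%:Z) = false by rewrite Ea /anum; lia.
  have topo' : topological (rcons od a).
    rewrite /topological pairwise_rcons -/(topological od) topo_od andbT; apply/allP => b b_od.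
    apply: contra a_od => /eqP Eb.
    have /mem_take : src b \in take qh qs by rewrite -odE mem_cat b_od.
    by rewrite qsE => /indegree0; apply.
  have deg_a := indegree_rcons (tgt a) a_od; rewrite eqxx in deg_a.
  have deg' v : v != tgt a -> indegree (rcons od a) v = indegree od v.
    by move=> neq; rewrite (indegree_rcons v a_od) eq_sym (negPf neq).
  pose upd := SetReg 10 (Minus (R 8) 1%:L) ;;
     SetCell 12 (R 9) (R 10) ;; incr 9 ;; SetReg 8 (Cell 10 (R 10)) ;;
     SetCell 8 (Cell 1 (R 10)) (Minus (Cell 8 (Cell 1 (R 10))) 1%:L).
  have -> : post sort_arcs_step st = if indegree (rcons od a) (tgt a) == 0%N then
      post (SetCell 11 (R 6) (Cell 1 (R 10)) ;; incr 6) (post upd st) else post upd st.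
    rewrite /= nz Ea' st1E eqxx deg_st deg_a; case: ifP => h1; case: ifP => h2 //; lia.
  have upd_cells : [/\ stores (post upd st) 12 (map (@anum I) (rcons od a)),
      reg (post upd st) 9 = (size (rcons od a))%:Z,
      chain (cell (post upd st) 10) (reg (post upd st) 8) rem
    & forall v, cell (post upd st) 8 (vnum v) = (indegree (rcons od a) v)%:Z].
    split.
    + by rewrite map_rcons; apply: stores_rcons od_st => i /=; rewrite cnt_st size_map Ea'.
    + by rewrite /= size_rcons cnt_st; lia.
    + by rewrite /= Ea'.
    + move=> v; rewrite /= Ea' st1E eq_vnum !deg_st.
      case: eqP => [->|/eqP neq]; first by rewrite deg_a; lia.
      by rewrite deg'.
  case: ifP => deg_0; last first.
    exists qs, qh, (rcons od a), rem; rewrite size_rcons; split=> //.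
    split; [split=> // | split=> //].
    + by rewrite cat_rcons.
    + by move=> b; rewrite cat_rcons.
    + move=> v; rewrite qsE; have [->|neq] := eqVneq v (tgt a); last by rewrite deg'.
      by rewrite deg_a deg_0.
  have new : tgt a \notin qs by rewrite qsE deg_a.
  have Etake : take qh (rcons qs (tgt a)) = take qh qs.
    by rewrite -cats1 takel_cat.
  exists (rcons qs (tgt a)), qh, (rcons od a), rem; rewrite size_rcons; split=> //.
  have [c1 c2 c3 c4] := upd_cells.
  split; [split=> // | split; split=> //].
  + by rewrite rcons_uniq new.
  + by rewrite cat_rcons.
  + by move=> b; rewrite cat_rcons Etake.
  + move=> v; rewrite mem_rcons inE qsE; have [->|neq] := eqVneq v (tgt a).
      by rewrite deg_0.
    by rewrite deg'.
  + rewrite map_rcons; apply: stores_rcons q_st => i /=.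
    by rewrite len_st size_map Ea' st1E.
  + by rewrite /= len_st size_rcons; lia.
  + by rewrite size_rcons ltnW.
- move=> k st fr [qs [qh [od [rem [[[uqs uod topo_od odE qsE] [[q_st len_st qh_st le_qh]
    [od_st cnt_st e_st deg_st]]] _]]]]] /=; rewrite negbK len_st qh_st => /eqP stop.
  have Erem : rem = [::].
    by case: rem => // a rem in uod odE e_st stop *; case: e_st stop; rewrite /anum; lia.
  have Eqh : qh = size qs by rewrite Erem /= in e_st; lia.
  rewrite Erem cats0 in uod odE; rewrite Eqh take_size in odE.
  have all_qs v : v \in qs.
    have [m] := ubnP (r v); elim: m v => // m IH v lt_m.
    rewrite qsE; apply/indegree0 => a Ea; rewrite odE IH //.
    by have := inc a; rewrite Ea; lia.
  have full a : a \in od by rewrite odE.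
  exists od; split=> //; rewrite -(card_uniqP uod); apply: eq_card => a.
  exact: full.
Qed.

End Sorting.

(** * Shortest-path labels, traced paths and output *)

(** The flag b tells whether the fixed arcs may be used. *)
Definition dist_array (b : bool) := if b then 15%N else 13%N.
Definition parent_array (b : bool) := if b then 16%N else 14%N.

Definition set_label b :=
  SetCell (dist_array b) (Cell 1 (R 10))
    (Plus (Cell (dist_array b) (Cell 0 (R 10))) (Cell 2 (R 10))) ;;
  SetCell (parent_array b) (Cell 1 (R 10)) (R 10).

Definition label_step (b : bool) :=
  SetReg 10 (Cell 12 (R 5)) ;;
  incr 5 ;;
  If (Leq (Cell 3 (R 10)) (b : nat)%:L)
    (If (Equal (Cell (dist_array b) (Cell 0 (R 10))) 0%:L) Skip
      (If (Equal (Cell (dist_array b) (Cell 1 (R 10))) 0%:L) (set_label b)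
        (If (Leq (Cell (dist_array b) (Cell 1 (R 10)))
                 (Plus (Cell (dist_array b) (Cell 0 (R 10))) (Cell 2 (R 10))))
          Skip (set_label b))))
    Skip.
Definition label_init b := SetCell (dist_array b) (R 2) 1%:L ;; SetReg 5 0%:L.
Definition label b := label_init b ;; While (Not (Leq (R 1) (R 5))) (label_step b).
Definition label_time b :=
  loop_cost (label_init b) (Not (Leq (R 1) (R 5))) (label_step b).

Definition trace_step b :=
  SetReg 10 (Cell (parent_array b) (R 12)) ;;
  SetCell 5 (R 10) (Plus (Cell 5 (R 10)) (R 13)) ;;
  SetCell 6 (R 10) (Plus (Cell 6 (R 10)) (R 14)) ;;
  SetReg 12 (Cell 0 (R 10)).

(** An unreached t is replaced by s, from which the loop exits at once. *)
Definition trace_init b :=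
  If (Equal (Cell (dist_array b) (R 3)) 0%:L) (SetReg 12 (R 2)) (SetReg 12 (R 3)).
Definition trace b := trace_init b ;; While (Not (Equal (R 12) (R 2))) (trace_step b).
Definition trace_time b :=
  loop_cost (trace_init b) (Not (Equal (R 12) (R 2))) (trace_step b).

(** Register 11 receives the first balance of s if the path that may use fixed
    arcs is cheaper, and 0 otherwise.  With r in register 11, the free path then
    adds (- r, 1) and the other path (r, 0) to the constant and the coefficient of
    its arcs. *)
Definition choose_rates :=
  If (Equal (Cell 15 (R 3)) 0%:L) (SetReg 11 0%:L)
    (If (Equal (Cell 13 (R 3)) 0%:L) (SetReg 11 (Cell 4 (R 2)))
      (If (Leq (Cell 13 (R 3)) (Cell 15 (R 3))) (SetReg 11 0%:L)
        (SetReg 11 (Cell 4 (R 2))))) ;;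
  SetReg 13 (Minus 0%:L (R 11)) ;; SetReg 14 1%:L.
Definition switch_rates := SetReg 13 (R 11) ;; SetReg 14 0%:L.

Definition compute :=
  read_arcs ;; find_sources ;; sort_arcs ;; label false ;; label true ;;
  choose_rates ;; trace false ;; switch_rates ;; trace true.

(** The coefficient in array 6 is 0 or 1, so a test replaces the multiplication.
    One loop runs over all pairs of a scenario and an arc. *)
Definition expand_step :=
  If (Equal (Cell 6 (R 6)) 0%:L) (SetCell 7 (R 7) (Cell 5 (R 6)))
    (SetCell 7 (R 7) (Plus (Cell 5 (R 6)) (Cell 4 (R 8)))) ;;
  incr 7 ;; incr 6 ;;
  If (Equal (R 6) (R 1))
    (SetReg 6 0%:L ;; incr 5 ;; SetReg 8 (Plus (R 8) (R 0))) Skip.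
Definition expand_init := SetReg 5 0%:L ;; SetReg 6 0%:L ;; SetReg 7 0%:L ;; SetReg 8 (R 2).
Definition expand := expand_init ;; While (Not (Leq (R 4) (R 5))) expand_step.
Definition expand_time := loop_cost expand_init (Not (Leq (R 4) (R 5))) expand_step.

Section Labelling.
Variables (I : instance) (s t : vertex (igraph I)).
Local Notation V := (vertex (igraph I)).
Local Notation A := (arc_of (igraph I)).
Implicit Types (a : A) (v : V) (st : state) (b : bool).
Let N := (#|V| + #|A|)%N.

Definition forbidden b : {set A} := if b then set0 else fixed I.

Definition holds_labels st b (L : labels I) : Prop :=
  (forall v, cell st (dist_array b) (vnum v) = (dist L v)%:Z) /\
  (forall v a, parent L v = Some a -> cell st (parent_array b) (vnum v) = anum a).

Lemma holds_labels_eq st st' b L :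
  cell st' (dist_array b) =1 cell st (dist_array b) ->
  cell st' (parent_array b) =1 cell st (parent_array b) ->
  holds_labels st b L -> holds_labels st' b L.
Proof. by move=> eqd eqp [hd hp]; split=> [v|v a Pa]; rewrite ?eqd ?eqp ?hd ?(hp v a). Qed.

(** One round of the program is one step of the mathematical relaxation. *)
Lemma relax_step st b (L : labels I) a :
  has_input s t st -> holds_labels st b L -> cell st 12 (reg st 5) = anum a ->
  holds_labels (post (label_step b) st) b (relax (forbidden b) L a).
Proof.
move=> [_ [st0E st1E st2E st3E _]] [hd hp] order_a.
have allowed : ((a \in fixed I : nat)%:Z <= (b : nat)%:Z :> int) = (a \notin forbidden b).
  by rewrite /forbidden; case: b {hd hp}; rewrite ?inE; case: (a \in fixed I).
have -> : post (label_step b) st =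
    let st1 := post (SetReg 10 (Cell 12 (R 5)) ;; incr 5) st in
    if improves (forbidden b) L a then post (set_label b) st1 else st1.
  rewrite /= order_a /improves st0E st1E st2E st3E !hd allowed !eqz_nat.
  case: (a \notin _) => //=; case: eqP => //= _; case: eqP => //= _.
  by rewrite -PoszD lez_nat ltnNge; case: leqP.
rewrite /relax; case: ifP => _; last by [].
case: b {allowed} hd hp => hd hp; split=> [v|v a'] /=;
  rewrite ?order_a ?st0E ?st1E ?st2E eq_vnum; case: (v =P tgt a) => //.
- by rewrite hd PoszD.
- by move=> _ [->].
- by move=> _; apply: hp.
- by rewrite hd PoszD.
- by move=> _ [->].
- by move=> _; apply: hp.
Qed.

Lemma run_label b st0 (od : seq A) : has_input s t st0 ->
  (forall v, cell st0 (dist_array b) (vnum v) = 0) ->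
  size od = #|A| -> stores st0 12 (map (@anum I) od) ->
  run (label b) st0 (label_time b * N)
    (fun st => holds_labels st b (tree_labels (forbidden b) s od)).
Proof.
move=> in0 blank size_od order; have N0 := input_size_gt0 s.
have safe : spares_input (label b) by case: b {blank}.
have order_st st : framed (label b) st0 st -> stores st 12 (map (@anum I) od).
  by move=> fr; apply: stores_eq order; apply: fr.2; case: b {blank fr safe}.
apply: (@run_loop _ _ _ _ (fun k st => exists l l', [/\ od = l ++ l',
   k = size l', reg st 5 = (size l)%:Z
   & holds_labels st b (tree_labels (forbidden b) s l)]) #|A|) => //.
- exact: leq_addl.
- exists [::], od; split=> //; have [[_ _ st2E _ _] _] := in0.
  split=> [v|//]; move: blank; rewrite /= st2E.
  by case: b {safe order_st} => /= blank; rewrite eq_vnum blank; case: eqP.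
- move=> k st fr [l [[|a l'] [E -> i_st lab_st]]];
    have in_st := input_framed fr safe in0.
    have [[_ nA _ _ _] _] := in_st.
    by rewrite /= i_st nA -size_od E cats0 lexx.
  move=> _; exists (size l'); first exact: ltnSn.
  exists (rcons l a), l'; split; rewrite ?cat_rcons ?size_rcons //.
    have -> : reg (post (label_step b) st) 5 = reg st 5 + 1.
      by case: b {blank safe order_st fr lab_st} => /=; do ?[case: ifP => //= _].
    by rewrite i_st; lia.
  rewrite /tree_labels foldl_rcons; apply: relax_step => //.
  rewrite i_st (order_st _ fr) ?size_map ?E ?size_cat ?addnS ?ltnS ?leq_addr //.
  by rewrite map_cat nth_cat size_map ltnn subnn.
- move=> k st fr [l [l' [E _ i_st lab_st]]].
  have [[_ nA _ _ _] _] := input_framed fr safe in0.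
  rewrite /= i_st nA negbK -size_od E size_cat lez_nat -[X in (_ <= X)%N]addn0 leq_add2l leqn0.
  by move=> /nilP ->; rewrite cats0.
Qed.

Variable r : V -> nat.
Hypothesis inc : forall a : A, (r (src a) < r (tgt a))%N.

(** The length plus one, with 0 for a missing path, so that it equals the stored
    distance in both cases. *)
Definition traced b L (P : option (seq A)) : Prop :=
  shortest_path (forbidden b) s t P /\
  (if P is Some p then (path_cost p).+1 else 0%N) = dist L t.

(** A walk in an acyclic graph repeats no arc, so each arc is increased once and
    the number of rounds is at most the number of arcs. *)
Lemma run_trace b st0 (od : seq A) (L := tree_labels (forbidden b) s od) :
  has_input s t st0 -> topological od -> (forall a, a \in od) -> holds_labels st0 b L ->
  run (trace b) st0 (trace_time b * N) (fun st => exists2 P, traced b L P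
    & forall a, cell st 5 (anum a) = cell st0 5 (anum a) + reg st0 13 * mem_path a P /\
                cell st 6 (anum a) = cell st0 6 (anum a) + reg st0 14 * mem_path a P).
Proof.
move=> in0 topo_od full_od lab0; have N0 := input_size_gt0 s.
have [[_ _ st2E st3E _] _] := in0.
have safe : spares_input (trace b) by case: b @L lab0.
have init_st : post (trace_init b) st0 =
    set_reg st0 12 (vnum (if dist L t == 0%N then s else t)).
  by have [hd _] := lab0; rewrite /= st3E hd eqz_nat st2E; case: ifP.
have [Lt|Lt] := posnP (dist L t).
  apply: (@run_loop _ _ _ _ (fun k st => reg st 12 = vnum s /\
     forall a, cell st 5 (anum a) = cell st0 5 (anum a) /\
               cell st 6 (anum a) = cell st0 6 (anum a)) 0) => //.
  - by rewrite init_st Lt.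
  - move=> k st fr [here _]; have [[_ _ st2E' _ _] _] := input_framed fr safe in0.
    by rewrite /= here st2E' eqxx.
  - move=> k st fr [_ same] _; exists None => [|a].
      by split; first exact: (shortest_path_None inc topo_od full_od).
    by have [-> ->] := same a; rewrite /mem_path /= !mulr0 !addr0.
apply: (@run_loop _ _ _ _ (fun k st => exists v p,
   [/\ reg st 12 = vnum v, is_walk v t p, avoids (forbidden b) p,
       (0 < dist L v)%N /\ (dist L v + path_cost p)%N = dist L t
     & k = (#|A| - size p)%N /\
     forall a, cell st 5 (anum a) = cell st0 5 (anum a) + reg st0 13 * (a \in p)%:Z /\
               cell st 6 (anum a) = cell st0 6 (anum a) + reg st0 14 * (a \in p)%:Z])
   #|A|) => //.
- exact: leq_addl.
- exists t, [::]; rewrite init_st gtn_eqF //; split; rewrite //= ?eqxx //.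
    by rewrite /path_cost big_nil addn0.
  by rewrite subn0; split=> // a; rewrite !mulr0 !addr0.
- move=> k st fr [v [p [here walk_p avoid_p [Lv cost_p] [-> cells]]]].
  have [[_ _ st2E' _ _] [st0E _ _ _ _]] := input_framed fr safe in0.
  have rate13 : reg st 13 = reg st0 13 by apply: fr.1; case: b @L fr {lab0 safe init_st Lt Lv cost_p avoid_p}.
  have rate14 : reg st 14 = reg st0 14 by apply: fr.1; case: b @L fr {lab0 safe init_st Lt Lv cost_p avoid_p rate13}.
  have [_ hp] : holds_labels st b L.
    by apply: holds_labels_eq lab0; apply: fr.2; case: b @L fr {safe init_st Lt Lv cost_p avoid_p}.
  rewrite /= here st2E' eq_vnum => neq.
  have [_ _ par] := tree_labelsP inc (forbidden b) s topo_od.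
  have [a [/hp par_a tgt_a _ aF [La Ea]]] := par v Lv neq.
  have walk_ap : is_walk (src a) t (a :: p) by rewrite /= eqxx tgt_a.
  have uniq_ap := walk_uniq inc walk_ap.
  have /= lt_p : (size (a :: p) <= #|A|)%N by rewrite -(card_uniqP uniq_ap) max_card.
  exists (#|A| - (size p).+1)%N; first by rewrite ltn_sub2l.
  exists (src a), (a :: p); split=> //.
  + by rewrite par_a st0E.
  + by rewrite /avoids /= aF.
  + by split=> //; rewrite path_cost_cons addnA -Ea.
  + split=> // a'; have [c5 c6] := cells a'.
    rewrite par_a rate13 rate14 !eq_anum inE.
    move: uniq_ap => /= /andP[/negPf a_p _].
    by case: eqP => [->|_] //=; rewrite -?c5 -?c6 //; have [-> ->] := cells a;
      rewrite a_p !mulr0 !addr0 !mulr1.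
- move=> k st fr [v [p [here walk_p avoid_p [Lv cost_p] [_ cells]]]].
  have [[_ _ st2E' _ _] _] := input_framed fr safe in0.
  rewrite /= here st2E' negbK eq_vnum => /eqP Ev; rewrite Ev in walk_p Lv cost_p.
  rewrite (dist_source inc) // add1n in cost_p.
  exists (Some p) => [|a]; last exact: cells.
  by split=> //; apply: (shortest_path_Some inc topo_od full_od).
Qed.

End Labelling.

(** * Running the two programs *)
Definition compute_time :=
  (read_arcs_time + (find_sources_time + (sort_arcs_time + (label_time false +
   (label_time true + (max_time choose_rates + (trace_time false +
   (max_time switch_rates + trace_time true))))))))%N.

Section Running.
Variables (I : instance) (s t : vertex (igraph I)).
Local Notation V := (vertex (igraph I)).
Local Notation A := (arc_of (igraph I)).
Implicit Types (a : A) (v : V) (st : state) (b : bool).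
Variable r : V -> nat.
Hypothesis inc : forall a : A, (r (src a) < r (tgt a))%N.

(** Arrays 5 and 6 hold the two coefficients of [two_paths_flowE]. *)
Definition computed st (pfree pfix : option (seq A)) : Prop :=
  forall a, cell st 6 (anum a) = mem_path a pfree /\
    cell st 5 (anum a) = (if cheaper pfix pfree
      then balance ord0 s * (mem_path a pfix - mem_path a pfree) else 0).

Lemma cheaper_dist (Lf Lx : labels I) (pfree pfix : option (seq A)) :
  traced s t false Lf pfree -> traced s t true Lx pfix ->
  cheaper pfix pfree = (dist Lx t != 0%N) &&
    ((dist Lf t == 0%N) || (dist Lx t < dist Lf t)%N).
Proof. by move=> [_ <-] [_ <-]; case: pfix pfree => [p|] [q|]. Qed.

Lemma run_compute :
  run compute (encode s t) (compute_time * (#|V| + #|A|)) (fun st =>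
    has_input s t st /\ exists pfree pfix,
      [/\ shortest_path (fixed I) s t pfree, shortest_path set0 s t pfix
        & computed st pfree pfix]).
Proof.
have N0 := input_size_gt0 s; have in0 := encode_input s t.
have blank := encode_blank s t; set st0 := encode s t in in0 blank *.
apply: run_seq (run_read_arcs in0 blank) _ => st1 fr1 [[outs adj1] deg1].
have in1 := input_framed fr1 isT in0.
apply: run_seq (run_find_sources in1 deg1) _ => st2 fr2 [qs [uniq_qs qsE q2 len2]].
have in2 := input_framed fr2 isT in1.
have adj2 : adjacency st2 outs.
  have [head1 uniq1 outsP] := adj1; split=> // v.
  by rewrite fr2.2 //; apply: chain_eq (head1 v) => a _; apply: fr2.2.
have deg2 v : cell st2 8 (vnum v) = (indegree [::] v)%:Z by rewrite fr2.2.
apply: run_seq (run_sort_arcs inc in2 adj2 deg2 uniq_qs qsE q2 len2) _.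
move=> st3 fr3 [od [topo_od size_od full_od order3]].
have in3 := input_framed fr3 isT in2.
have blank3 k : k \in [:: 13; 15]%N -> cell st3 k =1 (fun=> 0).
  by rewrite !inE => /orP[] /eqP-> i; rewrite fr3.2 // fr2.2 // fr1.2 // blank.
have blank_f v : cell st3 (dist_array false) (vnum v) = 0 by apply: blank3.
apply: run_seq (run_label in3 blank_f size_od order3) _ => st4 fr4 lab_f.
have in4 := input_framed fr4 isT in3.
have blank_x v : cell st4 (dist_array true) (vnum v) = 0 by rewrite fr4.2 // blank3.
have order4 : stores st4 12 (map (@anum I) od) by apply: stores_eq order3; apply: fr4.2.
apply: run_seq (run_label in4 blank_x size_od order4) _ => st5 fr5 lab_x.
have in5 := input_framed fr5 isT in4.
have {}lab_f : holds_labels st5 false (tree_labels (forbidden I false) s od).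
  by apply: holds_labels_eq lab_f; apply: fr5.2.
apply: run_seq (run_post st5 _ N0) _ => // st6 fr6 post6.
have in6 := input_framed fr6 isT in5.
have lab_f6 := holds_labels_eq (b := false) (fr6.2 13%N isT) (fr6.2 14%N isT) lab_f.
apply: run_seq (run_trace inc in6 topo_od full_od lab_f6) _.
move=> st7 fr7 [pfree tr_f cells7]; have in7 := input_framed fr7 isT in6.
apply: run_seq (run_post st7 _ N0) _ => // st8 fr8 post8.
have in8 := input_framed fr8 isT in7.
have lab_x8 : holds_labels st8 true (tree_labels (forbidden I true) s od).
  by apply: holds_labels_eq lab_x => i; rewrite fr8.2 // fr7.2 // fr6.2.
have [n [st9 [ex9 le9 [fr9 [pfix tr_x cells9]]]]] :=
  run_framed (run_trace inc in8 topo_od full_od lab_x8).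
exists n, st9; split=> //; split; first exact: input_framed fr9 isT in8.
exists pfree, pfix; split; [by case: tr_f | by case: tr_x | ].
have rate : reg st6 11 = if cheaper pfix pfree then balance ord0 s else 0.
  rewrite (cheaper_dist tr_f tr_x) -post6.
  have [[_ _ st2E st3E _] [_ _ _ _ st4E]] := in5.
  rewrite /= st2E st3E lab_f.1 lab_x.1 !eqz_nat (st4E ord0 s).
  by case: eqP => //= _; case: eqP => //= _; rewrite lez_nat ltnNge; case: leqP.
have [r13 r14] : reg st6 13 = - reg st6 11 /\ reg st6 14 = 1.
  by rewrite -post6 /= sub0r.
have [r13' r14'] : reg st8 13 = reg st6 11 /\ reg st8 14 = 0.
  by rewrite -post8 /= fr7.1.
move=> a; have [c5 c6] := cells9 a; have [c5' c6'] := cells7 a.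
have zero k : k \in [:: 5; 6]%N -> cell st6 k (anum a) = 0.
  rewrite !inE => /orP[] /eqP->;
    by rewrite fr6.2 // fr5.2 // fr4.2 // fr3.2 // fr2.2 // fr1.2 // blank.
rewrite c5 c6 !fr8.2 // c5' c6' !zero // r13 r14 r13' r14' rate.
by split; [ring | case: cheaper; ring].
Qed.

Lemma run_expand st0 pfree pfix : has_input s t st0 -> computed st0 pfree pfix ->
  (0 < #|A|)%N ->
  run expand st0 (expand_time * ((last_scen I).+1 * #|A|))
    (fun st => holds_flow st (two_paths_flow s pfree pfix)).
Proof.
move=> in0 comp0 A0; set L := (last_scen I).+1.
have out_inj (l l' j j' : nat) : (j < #|A|)%N -> (j' < #|A|)%N ->
    (l * #|A| + j = l' * #|A| + j')%N -> l = l' /\ j = j'.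
  move=> lt_j lt_j' E; have El : l = l'.
    have := congr1 (divn^~ #|A|) E.
    by rewrite !divnMDl // !divn_small // !addn0.
  by split=> //; move: E; rewrite El => /addnI.
apply: (@run_loop _ _ _ _ (fun k st => exists l j : nat,
  [/\ (j < #|A|)%N, (l <= L)%N, (l = L -> j = 0%N), k = (L * #|A| - (l * #|A| + j))%N
   & [/\ reg st 5 = l%:Z, reg st 6 = j%:Z, reg st 7 = (l * #|A| + j)%N%:Z,
      reg st 8 = (l * #|V| + enum_rank s)%N%:Z &
      forall (l' : 'I_L) a, (l' * #|A| + enum_rank a < l * #|A| + j)%N ->
       cell st 7 (l' * #|A| + enum_rank a)%N%:Z = two_paths_flow s pfree pfix l' a]])
  (L * #|A|)%N) => //.
- by rewrite muln_gt0.
- have [[_ _ st2E _ _] _] := in0.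
  by exists 0%N, 0%N; split=> //; rewrite ?subn0.
- move=> k st fr [l [j [lt_j le_l _ -> [l_st j_st out_st off_st flow_st]]]].
  have [[nV nA _ _ nL] [_ _ _ _ st4E]] := input_framed fr isT in0.
  move=> more.
  have lt_l : (l < L)%N by move: more; rewrite /= l_st nL lez_nat -ltnNge.
  pose a : A := enum_val (Ordinal lt_j); pose lo : 'I_L := Ordinal lt_l.
  have Ea : anum a = j%:Z by rewrite /anum enum_valK.
  have [c6 c5] := comp0 a; have Ebal := st4E lo s.
  have lt_out : (l * #|A| + j < L * #|A|)%N.
    by rewrite (@leq_trans (l.+1 * #|A|)) ?leq_mul2r ?lt_l ?orbT // mulSn addnC ltn_add2r.
  pose l1 := if j.+1 == #|A| then l.+1 else l.
  pose j1 := if j.+1 == #|A| then 0%N else j.+1.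
  have out1 : (l1 * #|A| + j1 = (l * #|A| + j).+1)%N.
    by rewrite /l1 /j1; case: eqP => [<-|_]; rewrite ?addn0 ?mulSn ?addnS // addSn addnC.
  exists (L * #|A| - (l1 * #|A| + j1))%N; first by rewrite out1 ltn_sub2l.
  exists l1, j1; split=> //.
  + by rewrite /j1; case: eqP => // /eqP; rewrite ltn_neqAle lt_j andbT.
  + by rewrite /l1; case: ifP => // _; apply: ltnW.
  + rewrite /l1 /j1; case: eqP => // _ El; by have := lt_l; rewrite [X in (X < _)%N]El ltnn.
  have -> : post expand_step st =
      let st1 := post (SetCell 7 (R 7) (Lit (two_paths_flow s pfree pfix lo a)) ;;
        incr 7 ;; incr 6) st in
      if j.+1 == #|A| then post (SetReg 6 0%:L ;; incr 5 ;; SetReg 8 (Plus (R 8) (R 0))) st1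
      else st1.
    have same x : x \in [:: 5; 6]%N -> cell st x =1 cell st0 x.
      by rewrite !inE => /orP[] /eqP->; apply: fr.2.
    have last_arc : (j%:Z + 1%:Z == #|A|%:Z) = (j.+1 == #|A|) by lia.
    have mem01 : mem_path a pfree = 0 \/ mem_path a pfree = 1.
      by rewrite /mem_path; case: on_path; [right | left].
    rewrite two_paths_flowE /= j_st off_st -Ea (same 6%N isT) (same 5%N isT) c5 c6 Ea.
    by case: mem01 => ->; rewrite /= ?mul0r ?mul1r ?addr0 ?Ebal j_st nA last_arc; case: ifP => //= _;
      rewrite ?off_st.
  have flow' (l' : 'I_L) a' : (l' * #|A| + enum_rank a' < (l * #|A| + j).+1)%N ->
      cell (set_cell st 7 (reg st 7) (two_paths_flow s pfree pfix lo a)) 7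
        (l' * #|A| + enum_rank a')%N%:Z = two_paths_flow s pfree pfix l' a'.
    move=> lt_out'; rewrite /= out_st eqz_nat; case: eqP => [E | /eqP neq].
      have [El Ej] := out_inj _ _ _ _ (ltn_ord _) lt_j E.
      have -> : l' = lo by apply: val_inj.
      by have -> : a' = a by apply: enum_rank_inj; rewrite enum_valK; apply: val_inj.
    by apply: flow_st; rewrite ltn_neqAle neq -ltnS.
  rewrite out1 /l1 /j1.
  rewrite /= out_st in flow'.
  by case: (j.+1 == #|A|) => /=; rewrite ?(l_st, j_st, out_st, off_st, nV);
    split; rewrite -?PoszD ?addn1 // mulSn addnC addnA.
- move=> k st fr [l [j [lt_j le_l last_l _ [l_st j_st out_st off_st flow_st]]]].
  have [[nV nA _ _ nL] _] := input_framed fr isT in0.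
  rewrite /= l_st nL negbK lez_nat => le_L.
  have El : l = L by apply/eqP; rewrite eqn_leq le_l.
  move=> l' a; apply: flow_st; rewrite El.
  rewrite (@leq_trans (l'.+1 * #|A|)) //; first by rewrite mulSn addnC ltn_add2r.
  by rewrite (leq_trans _ (leq_addr _ _)) // leq_mul2r ltn_ord orbT.
Qed.

End Running.

Lemma sp_has_arc (G : st_digraph) : series_parallel G -> (0 < #|arc_of G|)%N.
Proof.
elim=> {G} [G [_ _ [a _]] | G1 G2 G _ /card_gt0P[a _] _ _ [hV [hA _]]
  | G1 G2 G _ /card_gt0P[a _] _ _ [hV [hA _]]]; apply/card_gt0P; first by exists a.
  by exists (hA (inl a)).
by exists (hA (inl a)).
Qed.

Theorem theorem3 :
  (* correctness, whichever shortest paths are computed *)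
  (forall (I : instance) (s t : vertex (igraph I)),
     SP_digraph (igraph I) -> unique_source s -> unique_sink t ->
     sorted_scenarios s ->
     forall pfree pfix : option (seq (arc_of (igraph I))),
       shortest_path (fixed I) s t pfree ->
       shortest_path set0 s t pfix ->
       pfree != None \/ (exists f, @robust_flow I f) ->
       optimal_robust_flow (two_paths_flow s pfree pfix))
  /\
  (* running time: [compute] is the algorithm, [expand] writes its result out *)
  (exists (compute expand : cmd) (K : nat),
     forall (I : instance) (s t : vertex (igraph I)),
       SP_digraph (igraph I) -> unique_source s -> unique_sink t ->
       sorted_scenarios s ->
       exists pfree pfix : option (seq (arc_of (igraph I))),
         [/\ shortest_path (fixed I) s t pfree,
             shortest_path set0 s t pfix
           & exists (n : nat) (st : state),
             [/\ exec compute (encode s t) n st,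
                 (n <= K * (#|vertex (igraph I)| + #|arc_of (igraph I)|))%N,
                 holds_compact_flow s st (two_paths_flow s pfree pfix)
               & exists (n' : nat) (st' : state),
                 [/\ exec expand st n' st',
                     (n' <= K * ((last_scen I).+1 * #|arc_of (igraph I)|))%N
                   & holds_flow st' (two_paths_flow s pfree pfix)]]]).
Proof.
split; first exact: two_paths_optimal.
exists compute, expand, (compute_time + expand_time)%N.
move=> I s t [o [q sp]] src_s snk_t sorted_s.
have [r [_ _ _ inc]] := sp_rank sp; rewrite /= in r inc.
have [n [st [ex_c le_n [in_st [pfree [pfix [short_f short_x comp]]]]]]] :=
  run_compute s t inc.
exists pfree, pfix; split=> //; exists n, st; split=> //.
- by rewrite (leq_trans le_n) // leq_mul2r leq_addr orbT.
- by move=> l a; have [c6 c5] := comp a; rewrite two_paths_flowE -c5 -c6.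
have [n' [st' [ex_e le_n' flow]]] := run_expand in_st comp (sp_has_arc sp).
exists n', st'; split=> //.
by rewrite (leq_trans le_n') // leq_mul2r leq_addl orbT.
Qed.
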